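(* Assume that there is no $a\in\mathbb{Q}\setminus\{\pm1\}$ such that $f_a(z)=\frac{az^2+1}{z^3+az}$ has a $\mathbb{Q}$-rational periodic point of minimal period at least $4$. Then the possible $\mathbb{Q}$-rational preperiodic graphs of $f_a$ for $a\in\mathbb{Q}\setminus\{\pm1\}$ are the following. $G_1$: fixed points $1$ and $-1$, and the $2$-cycle $0\leftrightarrow\infty$ (total $4$ points); for $a$ not in one of the families $G_2,G_3,G_4$. $G_2$: fixed points $1$ and $-1$, each with exactly two non-periodic rational preimages, and the $2$-cycle $0\leftrightarrow\infty$ (total $8$ points); for $a=\frac{t^2+t+1}{t}$, $t\in\mathbb{Q}\setminus\{\pm1,0\}$. $G_3$: fixed points $1$ and $-1$, the $2$-cycle $0\leftrightarrow\infty$, and two further $2$-cycles (total $8$ points); for $a=\frac{-t^4-1}{2t^2}$, $t\in\mathbb{Q}\setminus\{\pm1,0\}$. $G_4$: fixed points $1$ and $-1$, and the $2$-cycle $0\leftrightarrow\infty$ in which each of $0$ and $\infty$ has exactly two non-periodic rational preimages (total $8$ points); for $a=-t^2$, $t\in\mathbb{Q}\setminus\{\pm1,0\}$.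
   Context: The $\mathbb{Q}$-rational preperiodic graph of $f$ is the directed graph whose vertices are the $\mathbb{Q}$-rational preperiodic points of $f$ in $\mathbb{P}^1(\mathbb{Q})$, with an edge $P\to f(P)$ for each vertex; in the descriptions all vertices and edges are listed. The values $a=\pm1$ are excluded since the map then has degree less than $3$. *)

(* Defs.v *)
From HB Require Import structures.
From mathcomp Require Import all_boot all_order all_algebra.

Set Implicit Arguments.
Unset Strict Implicit.
Unset Printing Implicit Defensive.

Import Order.TTheory GRing.Theory Num.Theory.

Local Open Scope ring_scope.

(* The projective line P^1(Q): [Some z] is the affine point z = [z : 1]. *)
Notation P1 := (option rat).
Notation pt z := (Some (z%R : rat) : P1).
Notation infty := (None : P1).

(* f_a(z) = (a z^2 + 1) / (z^3 + a z) as a self-map of P^1(Q).  It is the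
   genuine degree 3 morphism only for a <> 1, -1: then the numerator does not
   vanish at the zeros of the denominator, so these are poles.  The point at
   infinity goes to 0 because deg (a z^2 + 1) < deg (z^3 + a z). *)
Definition fa (a : rat) (P : P1) : P1 :=
  match P with
  | Some z =>
      if z ^+ 3 + a * z == 0 then infty
      else Some ((a * z ^+ 2 + 1) / (z ^+ 3 + a * z))
  | None => pt 0
  end.

Definition admissible (a : rat) : Prop := a <> 1 /\ a <> -1.

Section Dynamics.
Variables (T : Type) (f : T -> T).

Definition periodic (P : T) : Prop :=
  exists n : nat, (0 < n)%N /\ iter n f P = P.

Definition minimal_period (P : T) (n : nat) : Prop :=
  [/\ (0 < n)%N, iter n f P = P &
      forall m : nat, (0 < m < n)%N -> iter m f P <> P].

Definition preperiodic (P : T) : Prop :=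
  exists m : nat, periodic (iter m f P).

End Dynamics.

Record digraph (T : Type) := Digraph {
  vertex : T -> Prop;
  edge : T -> T -> Prop
}.

Definition preperiodic_graph (T : Type) (f : T -> T) : digraph T :=
  Digraph (preperiodic f) (fun P Q => preperiodic f P /\ Q = f P).

(* [vs] lists the vertices, without repetition, and [es] the edges. *)
Definition graph_listed (T : eqType) (G : digraph T)
    (vs : seq T) (es : seq (T * T)) : Prop :=
  [/\ uniq vs,
      forall P : T, vertex G P <-> P \in vs &
      forall P Q : T, edge G P Q <-> (P, Q) \in es].

Definition base_vertices : seq P1 := [:: pt 1; pt (-1); pt 0; infty].

Definition base_edges : seq (P1 * P1) :=
  [:: (pt 1, pt 1); (pt (-1), pt (-1)); (pt 0, infty); (infty, pt 0)].

Definition is_G1 (G : digraph P1) : Prop :=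
  graph_listed G base_vertices base_edges.

Definition is_G2 (G : digraph P1) : Prop :=
  exists u v u' v' : P1,
    graph_listed G (base_vertices ++ [:: u; v; u'; v'])
      (base_edges ++
       [:: (u, pt 1); (v, pt 1); (u', pt (-1)); (v', pt (-1))]).

Definition is_G3 (G : digraph P1) : Prop :=
  exists u v u' v' : P1,
    graph_listed G (base_vertices ++ [:: u; v; u'; v'])
      (base_edges ++ [:: (u, v); (v, u); (u', v'); (v', u')]).

Definition is_G4 (G : digraph P1) : Prop :=
  exists u v u' v' : P1,
    graph_listed G (base_vertices ++ [:: u; v; u'; v'])
      (base_edges ++ [:: (u, pt 0); (v, pt 0); (u', infty); (v', infty)]).

Definition parameter (t : rat) : Prop := [/\ t <> 1, t <> -1 & t <> 0].

Definition family2 (a : rat) : Prop :=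
  exists2 t : rat, parameter t & a = (t ^+ 2 + t + 1) / t.

Definition family3 (a : rat) : Prop :=
  exists2 t : rat, parameter t & a = (- t ^+ 4 - 1) / (2 * t ^+ 2).

Definition family4 (a : rat) : Prop :=
  exists2 t : rat, parameter t & a = - t ^+ 2.

(* Main.v *)
Require Import Defs.
From HB Require Import structures.
From Stdlib Require Import Classical_Prop.
From mathcomp Require Import all_boot all_order all_algebra.
From mathcomp Require Import zify ring lra.

(* The map f_a commutes with z -> -z and z -> 1/z.  Its fixed points are 1 and
   -1, the points of period 2 are 0, oo and the roots of z^4 + 2 a z^2 + 1, and
   each further phenomenon is controlled by an elliptic curve of rank 0: points
   of period 3 by y^2 = x (x^2 - 11 x + 64) (conductor 30), second preimages of 1
   and of oo by y^2 = x^3 + x^2 - x (conductor 20), preimages of the 2-cycles by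
   x^4 + 14 x^2 + 1 = y^2 (conductor 24), and the coincidence of two of the three
   families by y^2 = x^3 - x^2 + x (conductor 24) and x^4 + 6 x^2 + 1 = y^2,
   x^4 + 1 = 2 y^2 (conductor 32).  The rational points of all these curves are
   found by Fermat descent.  It follows that the preperiodic points are 0, 1, -1,
   oo, their first preimages and the points of period 2, and that at most one of
   the families applies to a given a. *)

Set Implicit Arguments.
Unset Strict Implicit.
Unset Printing Implicit Defensive.

(** * Fermat descent over the natural numbers *)

(** All descents run in [nat], so a difference is written as a sum on the other side, at the price
    of case splits on signs. A positive abscissa m/n in lowest terms on y^2 = x (x^2 + A x + B)
    makes m n N a square, where N is the homogenised quadratic factor. The three factors are
    pairwise coprime (for conductor 30, up to powers of 2), hence essentially squares, and the cubic
    becomes a quartic in their roots. The obstacle is that the quartics for conductors 20 and 30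
    have genuine solutions, so descent cannot simply end in a contradiction: the step is strict
    except when some factors are 1, and then the equation pins down the solution. The solutions left
    over correspond to a = -1, to points 0 or oo, or would make 3 a rational square. The hypothesis
    on long cycles bounds periods only. Tails are controlled by showing that a finite explicit set
    of points is closed under taking rational preimages. *)

Lemma coprime_primeP m n : 0 < n ->
  (forall p, prime p -> p %| m -> p %| n -> False) -> coprime m n.
Proof.
move=> n_gt0 noprime; rewrite /coprime; apply/eqP.
have g0 : 0 < gcdn m n by rewrite gcdn_gt0 n_gt0 orbT.
case: (ltnP 1 (gcdn m n)) => [g1|]; last by lia.
case: (noprime _ (pdiv_prime g1)); apply: dvdn_trans (pdiv_dvd _) _.
  exact: dvdn_gcdl.
exact: dvdn_gcdr.
Qed.

Lemma prime_dvdX p m k : prime p -> p %| m ^ k -> p %| m.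
Proof. by move=> p_pr; rewrite Euclid_dvdX // => /andP[]. Qed.

Lemma coprime_no_prime p m n : prime p -> coprime m n -> p %| m -> p %| n -> False.
Proof.
move=> p_pr cop pm pn; have : p %| gcdn m n by rewrite dvdn_gcd pm.
by rewrite (eqnP cop) dvdn1; case: eqP p_pr => // ->.
Qed.

Lemma gcdn_exp m n k : gcdn (m ^ k) (n ^ k) = gcdn m n ^ k.
Proof.
have [->|k_gt0] := posnP k; first by rewrite !expn0.
have [->|n_gt0] := posnP n; first by rewrite exp0n // !gcdn0.
have g0 : 0 < gcdn m n by rewrite gcdn_gt0 n_gt0 orbT.
have [m' Dm] := dvdnP (dvdn_gcdl m n); have [n' Dn] := dvdnP (dvdn_gcdr m n).
have cop : coprime m' n'.
  by rewrite /coprime -(eqn_pmul2r g0) muln_gcdl -Dm -Dn mul1n.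
set g := gcdn m n in Dm Dn *; rewrite Dm Dn !expnMn -muln_gcdl.
by rewrite (eqnP (coprimeXl k (coprimeXr k cop))) mul1n.
Qed.

Lemma coprime_mul_exp k A B y : 0 < k -> coprime A B -> A * B = y ^ k ->
  exists u v, [/\ A = u ^ k, B = v ^ k, y = u * v & coprime u v].
Proof.
move=> k_gt0 cop eAB.
(* The root is explicit: gcd(C, y)^k = gcd(C^k, C D) = C gcd(C^(k-1), D) = C. *)
have pow C D : coprime C D -> C * D = y ^ k -> C = gcdn C y ^ k.
  move=> copCD eCD; rewrite -gcdn_exp -eCD.
  by rewrite -(prednK k_gt0) expnS -muln_gcdr (eqnP (coprimeXl _ copCD)) muln1.
have eA := pow A B cop eAB.
have eB : B = gcdn B y ^ k by apply: (pow B A); rewrite 1?coprime_sym 1?mulnC.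
exists (gcdn A y), (gcdn B y); split=> //.
  by apply/eqP; rewrite -(eqn_exp2r _ _ k_gt0) expnMn -eA -eB eAB.
by rewrite -(coprime_pexpl _ _ k_gt0) -(coprime_pexpr _ _ k_gt0) -eA -eB.
Qed.

(** Coprimality splits c as gcd(A, c) gcd(B, c), and the cofactors are coprime with product y^k. The
    pairs (c1, c2) are the classes of a descent, to be eliminated one by one. *)
Lemma coprime_mul_cexp k c A B y :
  0 < k -> 0 < c -> coprime A B -> A * B = c * y ^ k ->
  exists c1 c2 u v,
    [/\ c = c1 * c2, A = c1 * u ^ k, B = c2 * v ^ k, y = u * v & coprime u v].
Proof.
move=> k_gt0 c_gt0 cop eAB.
have ec : gcdn A c * gcdn B c = c.
  have cop' : coprime (gcdn A c) (gcdn B c).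
    apply: coprime_dvdl (dvdn_gcdl _ _) _.
    exact: coprime_dvdr (dvdn_gcdl _ _) cop.
  apply/eqP; rewrite eqn_dvd Gauss_dvd // !dvdn_gcdr /=.
  have dA : c %| A * gcdn B c.
    by rewrite muln_gcdr dvdn_gcd eAB dvdn_mulr //= dvdn_mull.
  apply: dvdn_trans (_ : gcdn (A * gcdn B c) (c * gcdn B c) %| _).
    by rewrite dvdn_gcd dA dvdn_mulr.
  by rewrite -muln_gcdl.
have gA : 0 < gcdn A c by rewrite gcdn_gt0 c_gt0 orbT.
have gB : 0 < gcdn B c by rewrite gcdn_gt0 c_gt0 orbT.
have [A' DA] := dvdnP (dvdn_gcdl A c); have [B' DB] := dvdnP (dvdn_gcdl B c).
have copAB' : coprime A' B'.
  apply: (@coprime_dvdl _ A); first by rewrite DA dvdn_mulr.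
  by apply: (@coprime_dvdr _ B) => //; rewrite DB dvdn_mulr.
have eAB' : A' * B' = y ^ k.
  apply/eqP; rewrite -(eqn_pmul2l c_gt0) -eAB {1}DA {1}DB -{1}ec; apply/eqP; ring.
have [u [v [eA eB ey copuv]]] := coprime_mul_exp k_gt0 copAB' eAB'.
exists (gcdn A c), (gcdn B c), u, v; split=> //; first by rewrite -eA mulnC.
by rewrite -eB mulnC.
Qed.

(** * Pythagorean triples and sums and differences of fourth powers *)

Lemma pythagorean_triple a b c : coprime a b -> odd a -> ~~ odd b ->
  a ^ 2 + b ^ 2 = c ^ 2 ->
  exists m n, [/\ a + n ^ 2 = m ^ 2, b = 2 * m * n, c = m ^ 2 + n ^ 2 & coprime m n].
Proof.
move=> cop odda evenb e.
have lt_ac : a <= c by rewrite -leq_sqr; lia.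
have oddc : odd c by move/(congr1 odd): e; rewrite oddD !oddX /= odda (negbTE evenb).
have [b' eb] : exists b', b = 2 * b' by exists (b./2); lia.
have [n' en] : exists n', c = a + 2 * n' by exists ((c - a)./2); lia.
(* This is (c^2 - a^2) / 4 = (b / 2)^2, factored with c = a + 2 n'. *)
have e' : (a + n') * n' = b' ^ 2 by subst; lia.
have copn : coprime (a + n') n'.
  have [n0|n_gt0] := posnP n'.
    have b0: b' = 0 by move: e'; rewrite n0 muln0; nia.
    by move: cop; rewrite eb b0 n0 addn0.
  apply: coprime_primeP => // p p_pr.
  move=> pan pn; have pa : p %| a by rewrite -(dvdn_addl _ pn).
  apply: (coprime_no_prime p_pr cop pa).
  by rewrite eb dvdn_mull // (prime_dvdX (k := 2) p_pr) // -e' dvdn_mull.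
have [m [n [em en' emn copmn]]] := coprime_mul_exp (k := 2) isT copn e'.
by exists m, n; split=> //; lia.
Qed.

Lemma oddE n : odd n -> exists k, n = 2 * k + 1.
Proof. by exists (n./2); lia. Qed.

Lemma evenE n : ~~ odd n -> exists k, n = 2 * k.
Proof. by exists (n./2); lia. Qed.

(** Two nested triples. The triple (w, y^2, x^2) gives x^2 = m^2 + n^2 and y^2 = 2 m n, where m and
    n may need swapping to make n even. Then m = s^2 and n / 2 = t^2, and the triple (m, n, x) gives
    m = g^2 - h^2 with g h = t^2. So g = e0^2, h = f^2 and e0^4 = f^4 + s^2 with f < y. *)
Lemma fermat42_even x y w : coprime x y -> ~~ odd y -> 0 < y ->
  x ^ 4 = y ^ 4 + w ^ 2 -> False.
Proof.
have [N] := ubnP y; elim: N x y w => // N IHN x y w ltyN cop evy y_gt0 e.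
have oddx : odd x.
  apply/negPn/negP => evx; apply: (coprime_no_prime (p := 2)) cop _ _ => //; lia.
have oddw : odd w.
  by move/(congr1 odd): e; rewrite oddD !oddX /= oddx (negbTE evy).
have copxw : coprime (w) (y ^ 2).
  apply: coprime_primeP => [|p p_pr pw py]; first by lia.
  have {}py : p %| y := prime_dvdX p_pr py.
  apply: (coprime_no_prime p_pr cop) (py); apply: (prime_dvdX (k := 4)) => //.
  by rewrite e dvdn_add // expnS dvdn_mulr.
have evy2 : ~~ odd (y ^ 2) by rewrite oddX.
have e2 : w ^ 2 + (y ^ 2) ^ 2 = (x ^ 2) ^ 2 by lia.
have [m [n [ew ey ex copmn]]] := pythagorean_triple copxw oddw evy2 e2.
have main m' n' : coprime m' n' -> ~~ odd n' -> y ^ 2 = 2 * m' * n' ->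
    x ^ 2 = m' ^ 2 + n' ^ 2 -> False.
  move=> {m n ew ey ex copmn} cop' evn ey ex.
  have oddm : odd m'.
    by move/(congr1 odd): ex; rewrite oddD !oddX /= oddx (negbTE evn) addbF.
  have [n1 en1] := evenE evn; have [y1 ey1] := evenE evy.
  have copm1 : coprime m' n1 by apply: coprime_dvdr cop'; rewrite en1 dvdn_mull.
  have em1 : m' * n1 = y1 ^ 2 by move: ey; rewrite ey1 en1; clear; lia.
  have [s [t [es et eyst copst]]] := coprime_mul_exp (k := 2) isT copm1 em1.
  have [g [h [eg eh ex' copgh]]] := pythagorean_triple cop' oddm evn (esym ex).
  have gh : g * h = t ^ 2 by move: eh en1 et; clear; lia.
  have [e0 [f [eg' eh' etef copef]]] := coprime_mul_exp (k := 2) isT copgh gh.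
  have y_eq : y = 2 * s * e0 * f by rewrite ey1 eyst etef; clear; ring.
  have odds : odd s by move: oddm; rewrite es oddX.
  have es4 : e0 ^ 4 = f ^ 4 + s ^ 2.
    by rewrite -es -[4]/(2 * 2) !expnM -eg' -eh' -eg addnC.
  have [/andP[/andP[s_gt0 e_gt0] f_gt0]] : (0 < s) && (0 < e0) && (0 < f).
    by move: y_gt0; rewrite y_eq !muln_gt0.
  apply: (IHN e0 f s) => //.
  - have : f <= s * e0 * f by rewrite leq_pmull ?muln_gt0 ?s_gt0.
    by move: ltyN f_gt0; rewrite y_eq; clear; lia.
  - apply/negP => oddf.
    have : ~~ odd e0 by move/(congr1 odd): es4; rewrite oddD !oddX /= odds oddf => /= ->.
    move=> /evenE[k ek]; have [l el] := oddE oddf; have [j ej] := oddE odds.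
    by move: es4; rewrite ek el ej; clear; lia.
have := congr1 odd ex; rewrite oddD !oddX oddx /=.
case evn : (odd n) => /=.
  case evm : (odd m) => // _; apply: (main n m); rewrite ?evm //.
  - by rewrite coprime_sym.
  - by rewrite ey; ring.
  - by rewrite addnC.
by move=> _; apply: (main m n); rewrite ?evn.
Qed.

(** For odd y and nonzero w, the triple (y^2, w, x^2) gives y^2 = m^2 - n^2 and x^2 = m^2 + n^2 with
    n even. Their product m^4 = n^4 + (x y)^2 is the even case. *)
Lemma fermat42 x y w : coprime x y -> 0 < y -> x ^ 4 = y ^ 4 + w ^ 2 -> w = 0.
Proof.
move=> cop y_gt0 e; have [//|w_gt0] := posnP w.
case oddy : (odd y); last by case: (fermat42_even cop (negbT oddy) y_gt0 e).
have oddx : odd x.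
  apply/negPn/negP => /evenE[k ek]; have [l el] := oddE oddy.
  case: (boolP (odd w)) => [/oddE|/evenE] [j ej];
    by move: e; rewrite ek el ej; clear; lia.
have evw : ~~ odd w.
  by move/(congr1 odd): e; rewrite oddD !oddX /= oddx oddy; case: odd.
have copyw : coprime (y ^ 2) w.
  apply: coprime_primeP => // p p_pr py pw.
  have {}py : p %| y := prime_dvdX p_pr py.
  apply: (coprime_no_prime p_pr cop) (py); apply: (prime_dvdX (k := 4)) => //.
  by rewrite e dvdn_add // expnS dvdn_mulr.
have [||m [n [ey ew ex copmn]]] := pythagorean_triple (c := x ^ 2) copyw _ evw.
- by rewrite oddX.
- by move: e; clear; lia.
have evn : ~~ odd n.
  apply/negP => /oddE[k ek]; have [l el] := oddE oddy.
  case: (boolP (odd m)) => [/oddE|/evenE] [j ej];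
    by move: ey; rewrite ek el ej; clear; lia.
case: (@fermat42_even m n (x * y) copmn evn).
  by move: w_gt0; rewrite ew !muln_gt0 => /andP[].
by rewrite expnMn ex; move: ey; clear; nia.
Qed.

(** Squaring gives z^4 = (p q)^4 + ((p^4 - q^4) / 2)^2, so the last square vanishes by
    [fermat42]. *)
Lemma sum_fourth_powers p q z : coprime p q -> 0 < q -> q <= p ->
  p ^ 4 + q ^ 4 = 2 * z ^ 2 -> p = q.
Proof.
move=> cop q_gt0 leqp e.
have par : odd p = odd q.
  by move/(congr1 odd): e; rewrite oddD !oddX oddM /=; do 2!case: odd.
have oddp : odd p.
  apply/negPn/negP => evp; apply: (coprime_no_prime (p := 2)) cop _ _ => //; lia.
have oddq : odd q by rewrite -par.
have leqp4 : q ^ 4 <= p ^ 4 by rewrite leq_exp2r.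
have [w ew] : exists w, p ^ 4 = q ^ 4 + 2 * w.
  exists ((p ^ 4 - q ^ 4)./2); have := odd_double_half (p ^ 4 - q ^ 4).
  by rewrite oddB // !oddX /= oddp oddq /=; move: leqp4; clear; lia.
have e' : z ^ 4 = (p * q) ^ 4 + w ^ 2.
  have ez : z ^ 2 = q ^ 4 + w by move: e ew; clear; lia.
  by rewrite -[4]/(2 * 2) (expnM z) ez (expnMn _ _ (2 * 2)) ew; clear; ring.
have p_gt0 : 0 < p := leq_trans q_gt0 leqp.
have copz : coprime z (p * q).
  apply: coprime_primeP => [|r r_pr rz]; first by rewrite muln_gt0 p_gt0.
  have rs : r %| p ^ 4 + q ^ 4 by rewrite e dvdn_mull // expnS dvdn_mulr.
  rewrite Euclid_dvdM // => /orP[rp|rq].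
    apply: (coprime_no_prime r_pr cop rp); apply: (prime_dvdX (k := 4)) => //.
    by move: rs; rewrite dvdn_addr // expnS dvdn_mulr.
  apply: (coprime_no_prime r_pr cop) (rq); apply: (prime_dvdX (k := 4)) => //.
  by move: rs; rewrite dvdn_addl // expnS dvdn_mulr.
have w0 := fermat42 copz (_ : 0 < p * q) e'.
apply/eqP; rewrite -(eqn_exp2r _ _ (e := 4)) // ew w0 ?muln_gt0 ?p_gt0 //.
by rewrite muln0 addn0.
Qed.

(** * The quartic x^4 - x^2 y^2 + y^4 = z^2 (conductor 24) *)

Lemma gcdn_cofactors m n : 0 < n ->
  exists g n' m', [/\ n = n' * g, m = m' * g, 0 < g & coprime n' m'].
Proof.
move=> n_gt0; have g_gt0 : 0 < gcdn n m by rewrite gcdn_gt0 n_gt0.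
have [n' en] := dvdnP (dvdn_gcdl n m); have [m' em] := dvdnP (dvdn_gcdr n m).
exists (gcdn n m), n', m'; split=> //.
by rewrite /coprime -(eqn_pmul2r g_gt0) muln_gcdl -en -em mul1n.
Qed.

Lemma sqr_mod3 n : ~~ (3 %| n) -> exists k, n ^ 2 = 3 * k + 1.
Proof.
have := divn_eq n 3; have := ltn_pmod n (isT : 0 < 3).
rewrite /dvdn; case: (n %% 3) => [|[|[|//]]] // _ -> _.
  by exists (3 * (n %/ 3) ^ 2 + 2 * (n %/ 3)); ring.
by exists (3 * (n %/ 3) ^ 2 + 4 * (n %/ 3) + 1); ring.
Qed.

(* The four-number parametrisation turns a solution into c^2 = a^2 + d^2,
   b^2 = a^2 + 4 d^2; parametrising both triples gives a smaller solution. *)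
Lemma two_products_descent x y m n : coprime x y -> coprime m n ->
  0 < x * y -> x * y = 2 * m * n -> x ^ 2 + n ^ 2 = y ^ 2 + m ^ 2 -> False.
Proof.
have [N] := ubnP (x * y); elim: N x y m n => // N IHN x y m n.
wlog oddx : x y m n / odd x.
  move=> H lt cop cop' gt0 eM eD; case oddx : (odd x); first exact: (H x y m n).
  case oddy : (odd y).
    apply: (H y x n m); rewrite ?(mulnC y x) 1?coprime_sym // ?eM; clear; lia.
  by apply: (coprime_no_prime (p := 2)) cop _ _ => //; rewrite dvdn2 (oddx, oddy).
move=> ltxyN copxy copmn xy_gt0 eM eD.
have [x_gt0 y_gt0] : 0 < x /\ 0 < y by apply/andP; rewrite -muln_gt0.
have evy : ~~ odd y.
  by move/(congr1 odd): eM; rewrite -mulnA oddM [odd (2 * _)]oddM oddx /= => ->.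
have [y' ey'] := evenE evy.
have [oddm evn] : odd m /\ ~~ odd n.
  have [i ei] := oddE oddx; move: eD; rewrite ei ey'.
  case: (boolP (odd m)) => [/oddE|/evenE] [j ej];
  case: (boolP (odd n)) => [/oddE|/evenE] [k ek] //; rewrite ej ek; clear; lia.
have m_gt0 : 0 < m by case: (m) oddm.
have eM' : x * y' = m * n by move: eM; rewrite ey'; clear; lia.
have y'_gt0 : 0 < y' by lia.
have [a [b [c [eb ec a_gt0 copbc]]]] := gcdn_cofactors m x_gt0.
have ebc : b * y' = c * n.
  by apply/eqP; rewrite -(eqn_pmul2r a_gt0) -mulnAC -eb eM' ec mulnAC.
have [d ed] : exists d, n = b * d.
  have : b %| n by rewrite -(Gauss_dvdr _ copbc) -ebc dvdn_mulr.
  by case/dvdnP=> d ed; exists d; rewrite mulnC.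
have b_gt0 : 0 < b by move: x_gt0; rewrite eb; case: (b).
have ey2 : y' = c * d.
  by apply/eqP; rewrite -(eqn_pmul2l b_gt0) ebc ed mulnCA.
have key : b ^ 2 * (a ^ 2 + d ^ 2) = c ^ 2 * (a ^ 2 + 4 * d ^ 2).
  have -> : b ^ 2 * (a ^ 2 + d ^ 2) = x ^ 2 + n ^ 2 by rewrite eb ed; clear; ring.
  by rewrite eD ey' ey2 ec; clear; ring.
have d_gt0 : 0 < d by move: y'_gt0; rewrite ey2 muln_gt0 => /andP[].
have c_gt0 : 0 < c by move: y'_gt0; rewrite ey2 muln_gt0 => /andP[].
have copad : coprime a d.
  apply: coprime_dvdr (_ : d %| n) _; first by rewrite ed dvdn_mull.
  by apply: coprime_dvdl (_ : a %| m) _ => //; rewrite ec dvdn_mull.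
(* A common prime divides 3 d^2 and not d, so it is 3; but 3 divides a sum of two squares only if it
   divides both. *)
have copS : coprime (a ^ 2 + d ^ 2) (a ^ 2 + 4 * d ^ 2).
  apply: coprime_primeP => [|p p_pr p1 p2]; first by rewrite addn_gt0 expn_gt0 a_gt0.
  have p3d : p %| 3 * d ^ 2.
    by rewrite -(dvdn_addr _ p1); congr (_ %| _): p2; clear; lia.
  have nd : ~~ (p %| d).
    apply/negP=> pd; apply: (coprime_no_prime p_pr copad _ pd).
    apply: (prime_dvdX (k := 2) p_pr).
    by move: p1; rewrite dvdn_addl // expnS dvdn_mulr.
  have {p3d} : p %| 3.
    move: p3d; rewrite Euclid_dvdM // => /orP[//|/(prime_dvdX p_pr)].
    by rewrite (negbTE nd).
  rewrite dvdn_prime2 // => /eqP p3; subst p.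
  case/dvdnP: p1 => i ei; have [j ej] := sqr_mod3 nd.
  have [k [ek|ek]] : exists k, a ^ 2 = 3 * k \/ a ^ 2 = 3 * k + 1.
    case: (boolP (3 %| a)) => [/dvdnP[k ->]|/sqr_mod3[k ->]].
      by exists (3 * k ^ 2); left; ring.
    by exists k; right.
  - by move: ei; rewrite ej ek; clear; lia.
  - by move: ei; rewrite ej ek; clear; lia.
have e1 : c ^ 2 = a ^ 2 + d ^ 2.
  apply/eqP; rewrite eqn_dvd.
  have copbc2 : coprime (c ^ 2) (b ^ 2) by rewrite coprimeXl // coprimeXr // coprime_sym.
  rewrite -(Gauss_dvdr _ copbc2) key dvdn_mulr //=.
  by rewrite -(Gauss_dvdl _ copS) -key dvdn_mull.
have e2 : b ^ 2 = a ^ 2 + (2 * d) ^ 2.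
  have s_gt0 : 0 < a ^ 2 + d ^ 2 by rewrite addn_gt0 expn_gt0 a_gt0.
  apply/eqP; rewrite -(eqn_pmul2r s_gt0) key e1; apply/eqP; clear; ring.
have odda : odd a by move: oddx; rewrite eb oddM => /andP[].
have oddb : odd b by move: oddx; rewrite eb oddM => /andP[].
have evd : ~~ odd d by move: evn; rewrite ed oddM oddb.
have [k [l [ek el _ copkl]]] := pythagorean_triple copad odda evd (esym e1).
have [||K [L [eK eL _ copKL]]] := pythagorean_triple (b := 2 * d) _ odda _ (esym e2).
- by rewrite coprimeMr copad andbT coprimen2.
- by rewrite oddM.
have eKL : K * L = d by move: eL; clear; lia.
apply: (IHN K L k l) => //; rewrite ?eKL //.
- have : d <= c * d by rewrite leq_pmull.
  have : y <= x * y by rewrite leq_pmull.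
  by move: ltxyN d_gt0; rewrite ey' ey2; clear; lia.
- by move: ek eK; clear; lia.
Qed.

(** The equation says (x^2 - y^2)^2 + (x y)^2 = z^2. Apart from the solution x = y, parametrising
    this triple yields an instance of [two_products_descent], whichever leg is even. *)
Lemma quartic_m1_1 x y z : coprime x y -> 0 < x -> 0 < y ->
  x ^ 4 + y ^ 4 = z ^ 2 + x ^ 2 * y ^ 2 -> x = y.
Proof.
wlog leyx : x y / y <= x.
  move=> H cop x0 y0 e; case/orP: (leq_total y x) => le; first exact: H.
  by symmetry; apply: H; rewrite // 1?coprime_sym // addnC e mulnC.
move=> cop x_gt0 y_gt0 e; apply/eqP; rewrite eqn_leq leyx andbT leqNgt.
apply/negP => ltyx.
have ley2 : y ^ 2 < x ^ 2 by rewrite ltn_exp2r.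
have [w ew] : exists w, x ^ 2 = y ^ 2 + w by exists (x ^ 2 - y ^ 2); rewrite subnKC // ltnW.
have w_gt0 : 0 < w by move: ley2; rewrite ew; clear; lia.
have e2 : w ^ 2 + (x * y) ^ 2 = z ^ 2.
  by move: e; rewrite expnMn -[4]/(2 * 2) !expnM ew; clear; lia.
have copw : coprime w (x * y).
  apply: coprime_primeP => [|p p_pr pw]; first by rewrite muln_gt0 x_gt0.
  rewrite Euclid_dvdM // => /orP[px|py]; apply: (coprime_no_prime p_pr cop) => //.
    apply: (prime_dvdX (k := 2)) => //.
    by rewrite -(dvdn_addl _ pw) -ew expnS dvdn_mulr.
  by apply: (prime_dvdX (k := 2)) => //; rewrite ew dvdn_add // expnS dvdn_mulr.
case: (boolP (odd (x * y))) => [oddxy|evxy].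
  have evw : ~~ odd w.
    by move/(congr1 odd): ew; move: oddxy; rewrite oddM oddD !oddX /= => /andP[-> ->]; case: odd.
  rewrite coprime_sym addnC in copw e2.
  have [m [n [em en _ copmn]]] := pythagorean_triple copw oddxy evw e2.
  move: oddxy; rewrite oddM => /andP[oddx oddy].
  have [q eq_] : exists q, x = y + 2 * q.
    by exists ((x - y)./2); have := odd_double_half (x - y); rewrite oddB // oddx oddy; move: leyx; clear; lia.
  (* with p = y + q and q = (x - y)/2, xy = p^2 - q^2 and w = 4pq *)
  have emn : m * n = 2 * (y + q) * q by move: ew en; rewrite eq_; clear; lia.
  have q_gt0 : 0 < q by move: ltyx; rewrite eq_; clear; lia.
  have [m_gt0 n_gt0] : 0 < m /\ 0 < n.
    by apply/andP; rewrite -muln_gt0 emn !muln_gt0 q_gt0 addn_gt0 y_gt0.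
  have eD : m ^ 2 + q ^ 2 = n ^ 2 + (y + q) ^ 2 by move: em; rewrite eq_; clear; lia.
  have coppq : coprime (y + q) q.
    apply: coprime_primeP => // p p_pr pyq pq.
    have py : p %| y by move: pyq; rewrite dvdn_addl.
    by apply: (coprime_no_prime p_pr cop _ py); rewrite eq_ dvdn_add // dvdn_mull.
  by apply: (@two_products_descent m n (y + q) q); rewrite // muln_gt0 m_gt0.
have oddw : odd w.
  apply/negPn/negP => evw; apply: (coprime_no_prime (p := 2)) copw _ _ => //.
    by rewrite dvdn2.
  by rewrite dvdn2.
have [m [n [em en _ copmn]]] := pythagorean_triple copw oddw evxy e2.
apply: (@two_products_descent x y m n) => //; first by rewrite muln_gt0 x_gt0.
by move: ew em; clear; lia.
Qed.

(* Adding known equations to both sides reduces an identity in nat to [ring]. *)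
Lemma eq_comb a b m n : a = b -> m + a = n + b -> m = n.
Proof. by move=> ->; apply: addIn. Qed.

(** * The quartic x^4 + x^2 y^2 - y^4 = z^2 (conductor 20) *)

Lemma sqr_diff z d c : z ^ 2 = d ^ 2 + c ->
  exists b, z = d + b /\ b * (b + 2 * d) = c.
Proof.
move=> e; have ledz : d <= z by rewrite -leq_sqr e leq_addr.
exists (z - d); split; first by rewrite subnKC.
by move: e; rewrite -{1}(subnKC ledz); move: (z - d) => b; clear; lia.
Qed.

Lemma sqr_diff4 z d c : z ^ 2 = d ^ 2 + 4 * c ->
  exists b, z = d + 2 * b /\ b * (b + d) = c.
Proof.
move=> e; have [b [ez eb]] := sqr_diff e.
have evb : ~~ odd b.
  by move/(congr1 odd): eb; rewrite oddM oddD oddM [odd (4 * c)]oddM addbF andbb /= => ->.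
have [b' eb'] := evenE evb; exists b'; split; first by rewrite ez eb'.
by move: eb; rewrite eb'; clear; lia.
Qed.

Lemma prime_dvd_cofactor p A B c Y : prime p -> ~~ (p ^ 2 %| c) ->
  p %| A -> p %| B -> A * B = c * Y -> p %| Y.
Proof.
move=> p_pr npc pA pB e; apply: contraR npc => npY.
have cop : coprime (p ^ 2) Y by rewrite coprimeXl // prime_coprime.
by rewrite -(Gauss_dvdl _ cop) -e -mulnn dvdn_mul.
Qed.

(** Closes the descent: substituting v = h g into u^2 = v^2 + w or u^2 = v^2 - w returns the
    original quartic, with g and h in an order that depends on the sign. *)
Lemma quartic_20_step u v w g h : v = h * g -> g ^ 4 = h ^ 4 + w ->
  u ^ 2 = v ^ 2 + w \/ v ^ 2 = u ^ 2 + w -> coprime h g ->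
  exists g' h', [/\ v = h' * g', coprime g' h' & g' ^ 4 + g' ^ 2 * h' ^ 2 = h' ^ 4 + u ^ 2].
Proof.
move=> -> eg [eu|eu] cop.
  exists g, h; split; rewrite 1?coprime_sym // eu eg; clear; ring.
rewrite expnMn in eu.
by exists h, g; split; rewrite 1?mulnC // 1?mulnC ?eu ?eg; clear; ring.
Qed.

Lemma sqr_dist u v : exists w,
  (u ^ 2 = v ^ 2 + w \/ v ^ 2 = u ^ 2 + w) /\
  u ^ 4 + v ^ 4 = 2 * u ^ 2 * v ^ 2 + w ^ 2.
Proof.
rewrite -[4]/(2 * 2) !expnM; case/orP: (leq_total (u ^ 2) (v ^ 2)) => le.
  have [w ew] : exists w, v ^ 2 = u ^ 2 + w by exists (v ^ 2 - u ^ 2); rewrite subnKC.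
  by exists w; split; [right | rewrite ew; ring].
have [w ew] : exists w, u ^ 2 = v ^ 2 + w by exists (u ^ 2 - v ^ 2); rewrite subnKC.
by exists w; split; [left | rewrite ew; ring].
Qed.

Lemma prime_sqr_ndvd5 p : prime p -> ~~ (p ^ 2 %| 5).
Proof.
move=> p_pr; apply/negP => p25; have : p %| 5 by apply: dvdn_trans p25; rewrite dvdn_mulr.
by rewrite dvdn_prime2 // => /eqP p5; move: p25; rewrite p5.
Qed.

Lemma mul5 c1 c2 : 5 = c1 * c2 -> c1 = 1 /\ c2 = 5 \/ c1 = 5 /\ c2 = 1.
Proof.
move=> e; have : c1 %| 5 by rewrite e dvdn_mulr.
case/primeP: (isT : prime 5) => _ dv5 /dv5 /orP[] /eqP c1E; move: e; rewrite c1E.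
  by rewrite mul1n => <-; left.
by move/eqP; rewrite -{1}(muln1 5) eqn_pmul2l // => /eqP <-; right.
Qed.

(** Completing the square, (2 x^2 + y^2)^2 - (2 z)^2 = 5 y^4. For odd y the two factors are u^4 and
    5 v^4 with y = u v, so (2 x)^2 = (u^2 - v^2)^2 + 4 v^4. Factoring this difference of squares
    gives |u^2 - v^2| = g^4 - h^4 with v = h g, the input of [quartic_20_step]. Even y = 2 y' is the
    same with other powers of 2. *)
Lemma quartic_1_m1 x y z : coprime x y -> 0 < x -> 0 < y ->
  x ^ 4 + x ^ 2 * y ^ 2 = y ^ 4 + z ^ 2 -> x = 1 /\ y = 1.
Proof.
have [N] := ubnP y; elim: N x y z => // N IHN x y z ltyN cop x_gt0 y_gt0 e.
have sqr1 n : n ^ 2 = 1 -> n = 1 by case: n => [|[|n]] //; clear; lia.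
case: (boolP (odd y)) => [oddy|evy].
  have [|B [eS eB]] := @sqr_diff (2 * x ^ 2 + y ^ 2) (2 * z) (5 * y ^ 4).
    by move: e; clear; lia.
  have eAB : B * (B + 4 * z) = 5 * y ^ 4 by rewrite -eB; clear; ring.
  have copAB : coprime B (B + 4 * z).
    apply: coprime_primeP => [|p p_pr pB pA].
      have : 0 < 5 * y ^ 4 by rewrite muln_gt0 expn_gt0 y_gt0.
      by rewrite -eAB muln_gt0 => /andP[].
    have py : p %| y.
      apply: (prime_dvdX (k := 4)) => //.
      apply: (@prime_dvd_cofactor p B (B + 4 * z) 5) => //.
      exact: prime_sqr_ndvd5.
    apply: (coprime_no_prime p_pr cop _ py); apply: (prime_dvdX (k := 2)) => //.
    have : p %| 4 * x ^ 2.
      have e1 : (B + 4 * z) + B = 4 * x ^ 2 + 2 * y ^ 2 by move: eS; clear; lia.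
      have : p %| (B + 4 * z) + B by rewrite dvdn_add.
      by rewrite e1 dvdn_addl // dvdn_mull // expnS dvdn_mulr.
    rewrite Euclid_dvdM // => /orP[|//]; rewrite (_ : 4 = 2 ^ 2) // => /prime_dvdX-/(_ p_pr).
    by rewrite dvdn_prime2 // => /eqP p2; move: py; rewrite p2 dvdn2 oddy.
  have [c1 [c2 [u [v [ec eu ev ey copuv]]]]] := coprime_mul_cexp (k := 4) (c := 5) isT isT copAB eAB.
  have {c1 c2 u v ec eu ev ey copuv} [u [v [ey copuv euv]]] :
      exists u v, [/\ y = u * v, coprime u v & 4 * x ^ 2 + 2 * y ^ 2 = u ^ 4 + 5 * v ^ 4].
    case: (mul5 ec) => [[e1 e2]|[e1 e2]]; subst c1 c2.
      by exists u, v; split=> //; move: eS eu ev; clear; lia.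
    exists v, u; split; rewrite 1?mulnC 1?coprime_sym //.
    by move: eS eu ev; rewrite ey; clear; lia.
  have [u_gt0 v_gt0] : 0 < u /\ 0 < v by apply/andP; rewrite -muln_gt0 -ey.
  move: oddy; rewrite ey oddM => /andP[oddu oddv].
  have [w0 [ew0 ew04]] := sqr_dist u v.
  have [w ew] : exists w, w0 = 2 * w.
    apply: evenE; case: ew0 => /(congr1 odd); rewrite oddD !oddX oddu oddv /=; by case: odd.
  subst w0; have [|D [ex eD]] := @sqr_diff4 (2 * x) (2 * w) (v ^ 4).
    by apply: (eq_comb (esym ew04)); apply: (eq_comb (esym euv)); rewrite ey; ring.
  have copD : coprime D (D + 2 * w).
    apply: coprime_primeP => [|p p_pr pD].
      have : 0 < v ^ 4 by rewrite expn_gt0 v_gt0.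
      by rewrite -eD muln_gt0 => /andP[].
    rewrite dvdn_addr // => pw.
    have pv : p %| v by apply: (prime_dvdX (k := 4)); rewrite // -eD dvdn_mulr.
    apply: (coprime_no_prime p_pr copuv _ pv); apply: (prime_dvdX (k := 2)) => //.
    by case: ew0 => ew0; [rewrite ew0 dvdn_add|move: (ew0); rewrite -(dvdn_addl _ pw) -ew0] => //; rewrite expnS dvdn_mulr.
  have [h [g [eh eg ev cophg]]] := coprime_mul_exp (k := 4) isT copD eD.
  have [|g' [h' [ev' copgh' eq']]] := quartic_20_step ev (_ : g ^ 4 = h ^ 4 + 2 * w) ew0 cophg.
    by rewrite -eh eg.
  have [h'_gt0 g'_gt0] : 0 < h' /\ 0 < g' by apply/andP; rewrite -muln_gt0 -ev'.
  have [g1 h1] : g' = 1 /\ h' = 1.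
    (* Since y = u g' h', a failure of h' < y forces u = g' = 1, and then 1 + h'^2 = h'^4 + 1 leaves
       h' = 1. *)
    case: (ltnP h' y) => [lt|]; first by apply: (IHN g' h' u) => //; apply: leq_trans lt _.
    rewrite ey ev' => le.
    have : u * g' <= 1 by rewrite -(leq_pmul2r h'_gt0) mul1n -mulnA [g' * h']mulnC.
    case: (u) u_gt0 eq' => [|[|?]] //; case: (g') g'_gt0 => [|[|?]] // _ _ eq' _.
    split=> //; move: eq'; clear -h'_gt0; case: h' h'_gt0 => [|[|h]] // _; lia.
  have v1 : v = 1 by rewrite ev' g1 h1.
  have u1 : u = 1 by apply: sqr1; move: eq'; rewrite g1 h1; clear; lia.
  split; last by rewrite u1 v1.
  by apply: sqr1; move: euv; rewrite ey u1 v1; clear; lia.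
have oddx : odd x.
  apply/negPn/negP => evx; apply: (coprime_no_prime (p := 2)) cop _ _; by rewrite ?dvdn2.
have oddz : odd z.
  by move/(congr1 odd): e; rewrite !oddD oddM !oddX /= oddx (negbTE evy).
have [y' ey] := evenE evy.
have [B [eS eB]] : exists B, x ^ 2 + 2 * y' ^ 2 = z + 2 * B /\ B * (B + z) = 5 * y' ^ 4.
  by apply: sqr_diff4; apply: (eq_comb (esym e)); rewrite ey; ring.
have y'_gt0 : 0 < y' by move: y_gt0; rewrite ey; case: (y').
have copB : coprime B (B + z).
  apply: coprime_primeP => [|p p_pr pB pA].
    have : 0 < 5 * y' ^ 4 by rewrite muln_gt0 expn_gt0 y'_gt0.
    by rewrite -eB muln_gt0 => /andP[].
  have py : p %| y'.
    apply: (prime_dvdX (k := 4)) => //; apply: (@prime_dvd_cofactor p B (B + z) 5) => //.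
    exact: prime_sqr_ndvd5.
  apply: (coprime_no_prime p_pr cop); last by rewrite ey dvdn_mull.
  apply: (prime_dvdX (k := 2)) => //.
  have : p %| x ^ 2 + 2 * y' ^ 2.
    have -> : x ^ 2 + 2 * y' ^ 2 = B + (B + z) by rewrite eS; clear; ring.
    by rewrite dvdn_add.
  by rewrite dvdn_addl // dvdn_mull // expnS dvdn_mulr.
have [c1 [c2 [u [v [ec eu ev ey' copuv]]]]] := coprime_mul_cexp (k := 4) (c := 5) isT isT copB eB.
have {c1 c2 u v ec eu ev ey' copuv} [u [v [ey' copuv euv]]] :
    exists u v, [/\ y' = u * v, coprime u v & x ^ 2 + 2 * y' ^ 2 = u ^ 4 + 5 * v ^ 4].
  case: (mul5 ec) => [[e1 e2]|[e1 e2]]; subst c1 c2.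
    by exists u, v; split=> //; move: eS eu ev; clear; lia.
  exists v, u; split; rewrite 1?mulnC 1?coprime_sym //.
  by move: eS eu ev; rewrite ey'; clear; lia.
have [u_gt0 v_gt0] : 0 < u /\ 0 < v by apply/andP; rewrite -muln_gt0 -ey'.
have [w [ew ew4]] := sqr_dist u v.
have [|D [ex eD]] := @sqr_diff4 x w (v ^ 4).
  by apply: (eq_comb (esym ew4)); apply: (eq_comb (esym euv)); rewrite ey'; ring.
have copD : coprime D (D + w).
  apply: coprime_primeP => [|p p_pr pD].
    have : 0 < v ^ 4 by rewrite expn_gt0 v_gt0.
    by rewrite -eD muln_gt0 => /andP[].
  rewrite dvdn_addr // => pw.
  have pv : p %| v by apply: (prime_dvdX (k := 4)); rewrite // -eD dvdn_mulr.
  apply: (coprime_no_prime p_pr copuv _ pv); apply: (prime_dvdX (k := 2)) => //.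
  by case: ew => ew; [rewrite ew dvdn_add|move: (ew); rewrite -(dvdn_addl _ pw) -ew] => //; rewrite expnS dvdn_mulr.
have [h [g [eh eg ev cophg]]] := coprime_mul_exp (k := 4) isT copD eD.
have [|g' [h' [ev' copgh' eq']]] := quartic_20_step ev (_ : g ^ 4 = h ^ 4 + w) ew cophg.
  by rewrite -eh eg.
have [h'_gt0 g'_gt0] : 0 < h' /\ 0 < g' by apply/andP; rewrite -muln_gt0 -ev'.
have [g1 h1] : g' = 1 /\ h' = 1.
  apply: (IHN g' h' u) => //.
  have : h' <= u * g' * h' by rewrite leq_pmull ?muln_gt0 ?u_gt0.
  by move: ltyN h'_gt0; rewrite ey ey' ev'; clear; lia.
have v1 : v = 1 by rewrite ev' g1 h1.
have u1 : u = 1 by apply: sqr1; move: eq'; rewrite g1 h1; clear; lia.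
have w0 : w = 0 by case: ew; rewrite u1 v1; clear; lia.
(* For even y the step is strict and lands on the solution (1, 1); then w = 0 makes x = w + 2 D
   even, a contradiction. *)
by move: oddx; rewrite ex w0 add0n oddM.
Qed.

(** * The quartic x^4 - 11 x^2 y^2 + 64 y^4 = z^2 (conductor 30) *)

Lemma sqr_mod8 n : odd n -> exists k, n ^ 2 = 8 * k + 1.
Proof.
case/oddE=> m ->; have [k ek] : exists k, m * (m + 1) = 2 * k.
  by apply: evenE; rewrite oddM oddD addbT; case: odd.
by exists k; apply: (eq_comb (congr1 (muln 4) (esym ek))); ring.
Qed.

Lemma mul135 c1 c2 : c1 * c2 = 135 ->
  (c1, c2) \in [:: (1, 135); (3, 45); (5, 27); (9, 15);
                   (15, 9); (27, 5); (45, 3); (135, 1)].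
Proof.
move=> e; have : c1 \in divisors 135 by rewrite -dvdn_divisors // -e dvdn_mulr.
have -> : c2 = 135 %/ c1.
  by rewrite -e mulKn //; case: c1 e.
by rewrite (_ : divisors 135 = [:: 1; 3; 5; 9; 15; 27; 45; 135]) // !inE;
  do 7?[case/orP=> [/eqP -> //|]]; move/eqP->.
Qed.

Lemma mul4 c1 c2 : 4 = c1 * c2 -> (c1, c2) \in [:: (1, 4); (2, 2); (4, 1)].
Proof.
move=> e; have : c1 \in divisors 4 by rewrite -dvdn_divisors // e dvdn_mulr.
have -> : c2 = 4 %/ c1.
  by rewrite e mulKn //; case: c1 e.
by rewrite (_ : divisors 4 = [:: 1; 2; 4]) // !inE;
  do 2?[case/orP=> [/eqP -> //|]]; move/eqP->.
Qed.

(** The factor 4 goes entirely to one of the coprime factors D and D + X: the class (2, 2) would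
    make their sum S even. *)
Lemma sum_split4 D X t S : coprime D (D + X) -> odd S -> S = X + 2 * D ->
  D * (D + X) = 4 * t ^ 4 ->
  exists h g, [/\ t = h * g, coprime h g & S = h ^ 4 + 4 * g ^ 4].
Proof.
move=> cop oddS eS eD.
have [c1 [c2 [h [g [ec eh eg et cophg]]]]] := coprime_mul_cexp (k := 4) (c := 4) isT isT cop eD.
have eS' : S = c1 * h ^ 4 + c2 * g ^ 4 by rewrite -eh -eg eS; ring.
have := mul4 ec; rewrite !inE !xpair_eqE => /or3P[] /andP[/eqP e1 /eqP e2]; subst c1 c2.
- by exists h, g; split=> //; rewrite eS' mul1n.
- by move: oddS; rewrite eS' oddD !oddM.
- by exists g, h; rewrite mulnC coprime_sym eS' mul1n addnC.
Qed.

(* First half of the 2-descent on x^4 - 11 x^2 y^2 + 64 y^4 = z^2: completing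
   the square gives A - B and A * B = 135 Y^4, where 135 = -(11^2 - 4 * 64). *)
Lemma factor135 A B K Y : coprime K Y -> 0 < Y -> A * B = 135 * Y ^ 4 ->
  A + 22 * Y ^ 2 = B + K ^ 2 ->
  exists c1 c2 u v, [/\ Y = u * v, c1 * c2 = 135,
    K ^ 2 + c2 * v ^ 4 = c1 * u ^ 4 + 22 * u ^ 2 * v ^ 2 &
    coprime (c1 * u) (c2 * v) \/
    exists a b, [/\ a * b = 15, c1 = 3 * a, c2 = 3 * b & coprime (a * u) (b * v)]].
Proof.
move=> cop Y_gt0 eM eD.
have noprime p : prime p -> p %| A -> p %| B -> p %| Y -> False.
  move=> p_pr pA pB pY; apply: (coprime_no_prime p_pr cop _ pY).
  apply: (prime_dvdX (k := 2)) => //; rewrite -(dvdn_addr _ pB) -eD dvdn_add //.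
  by rewrite dvdn_mull // expnS dvdn_mulr.
have [A_gt0 B_gt0] : 0 < A /\ 0 < B.
  by apply/andP; rewrite -muln_gt0 eM muln_gt0 expn_gt0 Y_gt0.
(* The only prime whose square divides 135 = 3^3 * 5 is 3, so 3 is the only prime that A and B can
   share. *)
case: (boolP ((3 %| A) && (3 %| B))) => [/andP[/dvdnP[A' eA] /dvdnP[B' eB]]|no3].
  have eM' : A' * B' = 15 * Y ^ 4.
    by apply/eqP; rewrite -(eqn_pmul2l (isT : 0 < 9)); apply/eqP; apply: (eq_comb (esym eM)); rewrite eA eB; ring.
  have B'_gt0 : 0 < B' by move: B_gt0; rewrite eB; case: (B').
  have cop' : coprime A' B'.
    apply: coprime_primeP => // p p_pr pA pB.
    apply: (noprime p p_pr); rewrite ?eA ?eB ?dvdn_mulr //.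
    apply: (prime_dvdX (k := 4)) => //; apply: (prime_dvd_cofactor p_pr _ pA pB eM').
    apply/negP => p15; have : p %| 3 * 5 by apply: dvdn_trans p15; rewrite dvdn_mulr.
    by rewrite Euclid_dvdM // !dvdn_prime2 // => /orP[] /eqP ep; move: p15; rewrite ep.
  have [a [b [u [v [ec eu ev ey copuv]]]]] := coprime_mul_cexp (k := 4) (c := 15) isT isT cop' eM'.
  exists (3 * a), (3 * b), u, v; split=> //; first by rewrite mulnACA -ec.
    by apply: (eq_comb eD); rewrite eA eB eu ev ey; ring.
  right; exists a, b; split=> //.
  rewrite -(coprime_pexpl _ _ (isT : 0 < 4)) -(coprime_pexpr _ _ (isT : 0 < 4)) !expnMn.
  apply: coprime_dvdl (_ : _ %| A' ^ 4) _.
    by rewrite eu expnMn dvdn_mul // -expnM dvdn_exp2l.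
  apply: coprime_dvdr (_ : _ %| B' ^ 4) _.
    by rewrite ev expnMn dvdn_mul // -expnM dvdn_exp2l.
  by rewrite coprimeXl // coprimeXr.
have copAB : coprime A B.
  apply: coprime_primeP => // p p_pr pA pB; apply: (noprime p p_pr) => //.
  have e5 : A * B = 5 * (27 * Y ^ 4) by rewrite eM; ring.
  have := prime_dvd_cofactor p_pr (prime_sqr_ndvd5 p_pr) pA pB e5.
  rewrite Euclid_dvdM // => /orP[|]; last exact: prime_dvdX.
  rewrite (_ : 27 = 3 ^ 3) // => /prime_dvdX-/(_ p_pr); rewrite dvdn_prime2 // => /eqP p3.
  by case/negP: no3; rewrite -p3 pA.
have [c1 [c2 [u [v [ec eu ev ey copuv]]]]] := coprime_mul_cexp (k := 4) (c := 135) isT isT copAB eM.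
exists c1, c2, u, v; split=> //; first by apply: (eq_comb eD); rewrite eu ev ey; ring.
left; rewrite -(coprime_pexpl _ _ (isT : 0 < 4)) -(coprime_pexpr _ _ (isT : 0 < 4)) !expnMn.
apply: coprime_dvdl (_ : _ %| A ^ 4) _.
  by rewrite eu expnMn dvdn_mul // -expnM dvdn_exp2l.
apply: coprime_dvdr (_ : _ %| B ^ 4) _.
  by rewrite ev expnMn dvdn_mul // -expnM dvdn_exp2l.
by rewrite coprimeXl // coprimeXr.
Qed.

(* The classes c1 = 1 and c1 = 9 are merged by replacing u with r u. *)
Lemma quartic_135 A B K Y : coprime K Y -> 0 < Y -> A * B = 135 * Y ^ 4 ->
  A + 22 * Y ^ 2 = B + K ^ 2 ->
  (forall c1 c2 u v, Y = u * v -> coprime u v ->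
     K ^ 2 + c2 * v ^ 4 = c1 * u ^ 4 + 22 * u ^ 2 * v ^ 2 ->
     (c1, c2) \notin [:: (3, 45); (5, 27); (15, 9); (27, 5); (45, 3); (135, 1)]) ->
  exists r u v, [/\ (r == 1) && ~~ (3 %| u) || (r == 3), Y = u * v, coprime (r * u) v &
    (r * K) ^ 2 + 135 * v ^ 4 = (r * u) ^ 4 + 22 * (r * u) ^ 2 * v ^ 2].
Proof.
move=> cop Y_gt0 eM eD H.
have [c1 [c2 [u [v [ey ec e copuv]]]]] := factor135 cop Y_gt0 eM eD.
have copuv' : coprime u v.
  case: copuv => [|[a [b [_ _ _]]]]; rewrite coprimeMl !coprimeMr => /andP[_ /andP[_ ->]] //.
have := H _ _ _ _ ey copuv' e; have := mul135 ec.
rewrite !inE !xpair_eqE.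
case/orP=> [/andP[/eqP e1 /eqP e2] _|].
  exists 1, u, v; subst c1 c2; split; rewrite ?mul1n //; last by rewrite e mul1n.
  case: copuv => [|[a [b []]]]; last by move=> _; case: (a) => [|[]].
  rewrite mul1n coprimeMr => /andP[copu _]; rewrite eqxx orbF /=; apply/negP => u3.
  exact: (coprime_no_prime _ copu u3).
case/orP=> [/andP[/eqP -> /eqP ->]|] //.
case/orP=> [/andP[/eqP -> /eqP ->]|] //.
case/orP=> [/andP[/eqP e1 /eqP e2] _|]; last first.
  by do 3?[case/orP=> [/andP[/eqP -> /eqP ->]|] //]; move=> /andP[/eqP -> /eqP ->].
exists 3, u, v; subst c1 c2; split=> //; last first.
  by apply: (eq_comb (congr1 (muln 9) (esym e))); ring.
case: copuv => [|[a [b [_ ea eb]]]].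
  by rewrite !coprimeMl !coprimeMr.
have -> : a = 3 by move: ea; clear; lia.
by rewrite [coprime _ (b * v)]coprimeMr => /andP[].
Qed.

(** Modulo 8: u and v have opposite parity, so c1 = 1 (v even) or c2 = -1 (u even). Among the
    factorisations of 135 only (1, 135) and (9, 15) satisfy either congruence. *)
Lemma quartic_135_odd_even K c1 c2 u v : odd K -> coprime u v ->
  K ^ 2 + c2 * v ^ 4 = c1 * u ^ 4 + 22 * u ^ 2 * v ^ 2 ->
  (c1, c2) \notin [:: (3, 45); (5, 27); (15, 9); (27, 5); (45, 3); (135, 1)].
Proof.
move=> oddK cop e; apply/negP.
have [k ek] := sqr_mod8 oddK.
have pow4 n m : n ^ 2 = m -> n ^ 4 = m * m by move=> <-; rewrite mulnn -expnM.
have par : odd c1 -> odd c2 -> odd u = ~~ odd v.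
  move=> odd1 odd2; move/(congr1 odd): e.
  by rewrite !(oddD, oddX, oddM) /= oddK odd1 odd2 /= addbF => <-.
rewrite !inE !xpair_eqE; do ?[case/orP] => /andP[/eqP ec1 /eqP ec2]; subst c1 c2;
  move: (par isT isT); case: (boolP (odd v)) => [oddv|/evenE[j ev]] => [/negbT/evenE[i eu]|oddu].
all: try (have [j ej] := sqr_mod8 oddv; have ei : u ^ 2 = 4 * i ^ 2 by rewrite eu expnMn).
all: try (have [i ei] := sqr_mod8 oddu; have ej : v ^ 2 = 4 * j ^ 2 by rewrite ev expnMn).
all: move: e; rewrite ek (pow4 _ _ ei) (pow4 _ _ ej) ei ej.
all: try move: (i ^ 2) => i2; try move: (j ^ 2) => j2; clear; lia.
Qed.

(** Modulo 32 the equation reduces to c2 = c1 + 6, which fails for all the listed pairs. Modulo 16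
    would not suffice: (5, 27) and (45, 3) survive there. *)
Lemma quartic_135_even_odd x u v c1 c2 : odd x -> odd u -> odd v ->
  (4 * x) ^ 2 + c2 * v ^ 4 = c1 * u ^ 4 + 22 * u ^ 2 * v ^ 2 ->
  (c1, c2) \notin [:: (3, 45); (5, 27); (15, 9); (27, 5); (45, 3); (135, 1)].
Proof.
move=> oddx oddu oddv e; apply/negP.
have [k ek] := sqr_mod8 oddx; have [i ei] := sqr_mod8 oddu.
have [j ej] := sqr_mod8 oddv.
have pow4 n m : n ^ 2 = m -> n ^ 4 = m * m by move=> <-; rewrite mulnn -expnM.
rewrite !inE !xpair_eqE; do ?[case/orP] => /andP[/eqP ec1 /eqP ec2]; subst c1 c2;
  move: e; rewrite expnMn ek (pow4 _ _ ei) (pow4 _ _ ej) ei ej; clear; lia.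
Qed.

(* K^2 = (U^2 + 27 v^2) (U^2 - 5 v^2) with coprime factors forces v even; the
   second half of the 2-descent then returns to the same equation. *)
Lemma quartic_m11_64_odd_even x y z : odd x -> coprime x (2 * y) -> 0 < y ->
  x ^ 4 + 1024 * y ^ 4 = z ^ 2 + 44 * x ^ 2 * y ^ 2 -> False.
Proof.
have [N] := ubnP y; elim: N x y z => // N IHN x y z ltyN oddx cop y_gt0 e.
have copxy : coprime x y by move: cop; rewrite coprimeMr => /andP[].
have oddz : odd z.
  by move/(congr1 odd): e; rewrite !(oddD, oddX, oddM) /= oddx; case: (odd z).
(* The equation is z^2 = (x^2 - 22 y^2)^2 + 4 * 135 y^4; the two cases are the signs of x^2 - 22 y^2
   = A - B. *)
have [A [B [eM eD]]] : exists A B, A * B = 135 * y ^ 4 /\ A + 22 * y ^ 2 = B + x ^ 2.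
  case/orP: (leq_total (22 * y ^ 2) (x ^ 2)) => le.
    have [d ed] : exists d, x ^ 2 = 22 * y ^ 2 + d by exists (x ^ 2 - 22 * y ^ 2); rewrite subnKC.
    have [|b [_ eb]] := @sqr_diff4 z d (135 * y ^ 4).
      apply: (eq_comb e); rewrite -[4]/(2 * 2) [x ^ (2 * 2)]expnM ed; ring.
    by exists (b + d), b; rewrite mulnC eb; split=> //; rewrite ed; ring.
  have [d ed] : exists d, 22 * y ^ 2 = x ^ 2 + d by exists (22 * y ^ 2 - x ^ 2); rewrite subnKC.
  have [|b [_ eb]] := @sqr_diff4 z d (135 * y ^ 4).
    apply: (eq_comb e); apply: (eq_comb (congr1 (muln (22 * y ^ 2)) (esym ed))).
    apply: (eq_comb (congr1 (muln (x ^ 2)) ed)).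
    apply: (eq_comb (congr1 (muln d) (esym ed))); ring.
  by exists b, (b + d); rewrite eb; split=> //; rewrite ed; ring.
have [|r [u [v [hr ey copuv eq']]]] := quartic_135 copxy y_gt0 eM eD.
  by move=> c1 c2 u v _; apply: quartic_135_odd_even.
have oddr : odd r by case/orP: hr => [/andP[/eqP->]|/eqP->].
have [U eU] : exists U, U = r * u by exists (r * u).
have [X eX] : exists X, X = r * x by exists (r * x).
rewrite -?eU -?eX in copuv eq'.
have X_odd : odd X by rewrite eX oddM oddr.
have parU : odd U = ~~ odd v.
  move/(congr1 odd): eq'; rewrite !(oddD, oddX, oddM) /= X_odd; do 2?case: odd => //.
have v_gt0 : 0 < v by move: y_gt0; rewrite ey muln_gt0 => /andP[].
set F := U ^ 2 + 27 * v ^ 2.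
have F_gt0 : 0 < F by rewrite /F addn_gt0 orbC muln_gt0 expn_gt0 v_gt0.
have eF : F * U ^ 2 = X ^ 2 + F * (5 * v ^ 2).
  by apply: (eq_comb eq'); rewrite /F; ring.
have [E eE] : exists E, U ^ 2 = 5 * v ^ 2 + E.
  exists (U ^ 2 - 5 * v ^ 2); rewrite subnKC // -(leq_pmul2l F_gt0) eF leq_addl //.
have eFE : F * E = X ^ 2.
  by apply/eqP; rewrite -(eqn_add2r (F * (5 * v ^ 2))) -eF eE; apply/eqP; ring.
have oddF : odd F by rewrite /F !(oddD, oddX, oddM) parU; case: odd.
have copF : coprime F E.
  rewrite coprime_sym; apply: coprime_primeP => // p p_pr pE.
  have -> : F = E + 2 ^ 5 * v ^ 2 by rewrite /F eE; ring.
  rewrite dvdn_addr // Euclid_dvdM // => /orP[/(prime_dvdX p_pr)|/(prime_dvdX p_pr) pv].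
    rewrite dvdn_prime2 // => /eqP p2.
    have : p %| X by apply: (prime_dvdX (k := 2)); rewrite // -eFE dvdn_mull.
    by rewrite p2 dvdn2 X_odd.
  apply: (coprime_no_prime p_pr copuv _ pv); apply: (prime_dvdX (k := 2)) => //.
  by rewrite eE dvdn_add // dvdn_mull // expnS dvdn_mulr.
have [al [be [eal _ _ _]]] := coprime_mul_exp (k := 2) isT copF eFE.
(* If v is odd then U is even and F = U^2 + 27 v^2 is 3 modulo 4, not a square. *)
have evv : ~~ odd v.
  apply/negP => oddv; have [j ej] := sqr_mod8 oddv.
  have [i ei] : exists i, U = 2 * i by apply: evenE; rewrite parU oddv.
  have [k ek] : exists k, al ^ 2 = 8 * k + 1.
    by apply: sqr_mod8; move: oddF; rewrite eal oddX.
  by move: eal; rewrite ek /F ei ej expnMn; clear; lia.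
have oddU : odd U by rewrite parU evv.
have [w ew] := evenE evv.
(* Since 11^2 + 135 = 256, completing the square gives (U^2 + 11 v^2)^2 = X^2 + 16 (2 v)^4. *)
have [|D [eS eM']] := @sqr_diff4 (U ^ 2 + 11 * v ^ 2) X (4 * (2 * v) ^ 4).
  by apply: (eq_comb eq'); ring.
have oddS : odd (U ^ 2 + 11 * v ^ 2) by rewrite !(oddD, oddX, oddM) oddU (negbTE evv).
have copD : coprime D (D + X).
  apply: coprime_primeP => [|p p_pr pD pDX]; first by rewrite addn_gt0 orbC; case: (X) X_odd.
  have pS : p %| U ^ 2 + 11 * v ^ 2.
    have -> : U ^ 2 + 11 * v ^ 2 = D + (D + X) by rewrite eS; ring.
    by rewrite dvdn_add.
  have p2 : p != 2 by apply/eqP => p2; move: pS; rewrite p2 dvdn2 oddS.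
  have pv : p %| v.
    have : p %| 2 ^ 6 * v ^ 4.
      by rewrite (_ : _ * _ = 4 * (2 * v) ^ 4); [rewrite -eM' dvdn_mulr | ring].
    rewrite Euclid_dvdM // => /orP[/(prime_dvdX p_pr)|]; last exact: prime_dvdX.
    by rewrite dvdn_prime2 // (negbTE p2).
  apply: (coprime_no_prime p_pr copuv _ pv); apply: (prime_dvdX (k := 2)) => //.
  by move: pS; rewrite dvdn_addl // dvdn_mull // expnS dvdn_mulr.
have [h [g [ehg cophg eS']]] := sum_split4 copD oddS eS eM'.
have oddh : odd h by move: oddS; rewrite eS' !(oddD, oddX, oddM) /= addbF.
have [g' eg] : exists g', g = 4 * g'.
  have : 4 %| h * g by rewrite -ehg ew mulnA dvdn_mulr.
  rewrite Gauss_dvdr; first by case/dvdnP=> g' ->; exists g'; rewrite mulnC.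
  by rewrite -[4]/(2 ^ 2) coprimeXl // coprime2n.
have ev : v = 2 * h * g' by move: ehg; rewrite eg; clear; lia.
have g'_gt0 : 0 < g' by move: v_gt0; rewrite ev; case: (g'); rewrite // muln0.
have u_gt0 : 0 < u by move: y_gt0; rewrite ey muln_gt0 => /andP[].
have h_gt0 : 0 < h by case: (h) oddh.
apply: (IHN h g' U) => //.
- have : g' <= u * h * g' by rewrite leq_pmull // muln_gt0 u_gt0.
  by move: ltyN g'_gt0; rewrite ey ev; clear; lia.
- rewrite coprimeMr coprimen2 oddh /=; apply: coprime_dvdr cophg.
  by rewrite eg dvdn_mull.
by apply: (eq_comb eS'); rewrite eg ev; ring.
Qed.

(** This is the conductor 30 quartic at (2 x, y), divided by 4. Here (8 x^2 - 11 y^2)^2 + 135 y^4 =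
    (4 z)^2, and the second half of the descent gives 4 h^4 + 16 g^4 = U^2 + 11 h^2 g^2 with y = u h
    g, the same equation. The solution (1, 1) reproduces itself through the class r = 3. *)
Lemma quartic_4_m11_16 x y z : odd x -> odd y -> coprime x y ->
  4 * x ^ 4 + 16 * y ^ 4 = z ^ 2 + 11 * x ^ 2 * y ^ 2 -> x = 1 /\ y = 1.
Proof.
have [N] := ubnP y; elim: N x y z => // N IHN x y z ltyN oddx oddy cop e.
have sqr1 n : n ^ 2 = 1 -> n = 1 by case: n => [|[|n]] //; clear; lia.
have y_gt0 : 0 < y by case: (y) oddy.
have cop4 : coprime (4 * x) y by rewrite coprimeMl cop andbT -[4]/(2 ^ 2) coprimeXl // coprime2n.
have [A [B [eM eD]]] : exists A B, A * B = 135 * y ^ 4 /\ A + 22 * y ^ 2 = B + (4 * x) ^ 2.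
  case/orP: (leq_total (11 * y ^ 2) (8 * x ^ 2)) => le.
    have [d ed] : exists d, 8 * x ^ 2 = 11 * y ^ 2 + d by exists (8 * x ^ 2 - 11 * y ^ 2); rewrite subnKC.
    have [|b [_ eb]] := @sqr_diff (4 * z) d (135 * y ^ 4).
      apply: (eq_comb (congr1 (muln 16) e)).
      apply: (eq_comb (congr1 (muln (8 * x ^ 2)) (esym ed))).
      apply: (eq_comb (congr1 (muln (11 * y ^ 2)) ed)).
      apply: (eq_comb (congr1 (muln d) (esym ed))); ring.
    exists (b + 2 * d), b; rewrite mulnC eb; split=> //.
    by apply: (eq_comb (congr1 (muln 2) ed)); ring.
  have [d ed] : exists d, 11 * y ^ 2 = 8 * x ^ 2 + d by exists (11 * y ^ 2 - 8 * x ^ 2); rewrite subnKC.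
  have [|b [_ eb]] := @sqr_diff (4 * z) d (135 * y ^ 4).
    apply: (eq_comb (congr1 (muln 16) e)).
    apply: (eq_comb (congr1 (muln (11 * y ^ 2)) (esym ed))).
    apply: (eq_comb (congr1 (muln (8 * x ^ 2)) ed)).
    apply: (eq_comb (congr1 (muln d) (esym ed))); ring.
  exists b, (b + 2 * d); rewrite eb; split=> //.
  by apply: (eq_comb (congr1 (muln 2) (esym ed))); ring.
have [|r [u [v [hr ey copuv eq']]]] := quartic_135 cop4 y_gt0 eM eD.
  move=> c1 c2 u v ey _; apply: quartic_135_even_odd => //;
  by move: oddy; rewrite ey oddM => /andP[].
have [oddu oddv] : odd u /\ odd v by move: oddy; rewrite ey oddM => /andP[].
have oddr : odd r by case/orP: hr => [/andP[/eqP->]|/eqP->].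
have [U eU] : exists U, U = r * u by exists (r * u).
rewrite -eU in copuv eq'.
have oddU : odd U by rewrite eU oddM oddr.
have [i ei] := sqr_mod8 oddU; have [j ej] := sqr_mod8 oddv.
have [S eS] : exists S, U ^ 2 + 11 * v ^ 2 = 4 * S /\ odd S.
  exists (2 * (i + 11 * j + 1) + 1); rewrite ei ej; split; first by ring.
  by rewrite oddD oddM.
have [eS4 oddS] := eS.
have [|D [eSD eM']] := @sqr_diff4 S (r * x) (4 * v ^ 4).
  apply/eqP; rewrite -(eqn_pmul2l (isT : 0 < 16)); apply/eqP.
  have -> : 16 * S ^ 2 = (U ^ 2 + 11 * v ^ 2) ^ 2 by rewrite eS4; ring.
  by apply: (eq_comb eq'); ring.
have v_gt0 : 0 < v by case: (v) oddv.
have copD : coprime D (D + r * x).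
  apply: coprime_primeP => [|p p_pr pD pDX].
    by rewrite addn_gt0 muln_gt0 orbC; case: (r) oddr; case: (x) oddx.
  have pS : p %| S.
    have -> : S = D + (D + r * x) by rewrite eSD; ring.
    by rewrite dvdn_add.
  have p2 : p != 2 by apply/eqP => p2; move: pS; rewrite p2 dvdn2 oddS.
  have pv : p %| v.
    have : p %| 2 ^ 2 * v ^ 4 by rewrite -[2 ^ 2]/4 -eM' dvdn_mulr.
    rewrite Euclid_dvdM // => /orP[/(prime_dvdX p_pr)|]; last exact: prime_dvdX.
    by rewrite dvdn_prime2 // (negbTE p2).
  apply: (coprime_no_prime p_pr copuv _ pv); apply: (prime_dvdX (k := 2)) => //.
  have : p %| U ^ 2 + 11 * v ^ 2 by rewrite eS4 dvdn_mull.
  by rewrite dvdn_addl // dvdn_mull // expnS dvdn_mulr.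
have [h [g [ehg cophg eS']]] := sum_split4 copD oddS eSD eM'.
have [oddh oddg] : odd h /\ odd g by move: oddv; rewrite ehg oddM => /andP[].
have eq2 : 4 * h ^ 4 + 16 * g ^ 4 = U ^ 2 + 11 * h ^ 2 * g ^ 2.
  by apply: (eq_comb eS4); rewrite eS' ehg; ring.
have u_gt0 : 0 < u by case: (u) oddu.
have h_gt0 : 0 < h by case: (h) oddh.
have g_gt0 : 0 < g by case: (g) oddg.
have [h1 g1] : h = 1 /\ g = 1.
  (* Without strict decrease u = h = 1 and U = r, so 16 g^4 + 4 = r^2 + 11 g^2 with r = 1 or 3,
     which bounds g by 1. *)
  case: (ltnP g y) => [lt|]; first by apply: (IHN h g U) => //; apply: leq_trans lt _.
  rewrite ey ehg => le.
  have : u * h <= 1 by rewrite -(leq_pmul2r g_gt0) mul1n -mulnA.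
  rewrite leq_eqVlt ltnNge muln_gt0 u_gt0 h_gt0 orbF muln_eq1 => /andP[/eqP u1 /eqP h1].
  split=> //; move: eq2; rewrite eU u1 h1 => eq2.
  have : g ^ 2 <= 1.
    rewrite leqNgt; apply/negP => g2; have : 2 * g ^ 2 <= g ^ 4.
      by rewrite -[4]/(2 * 2) expnM -mulnn leq_mul2r g2 orbT.
    by case/orP: hr => [/andP[/eqP er _]|/eqP er]; move: eq2 g2; rewrite er; clear; lia.
  by case: (g) g_gt0 => [|[|g2]] //; clear; lia.
have v1 : v = 1 by rewrite ehg h1 g1.
have U3 : U = 3.
  move: eq2; rewrite h1 g1; clear; case: U => [|[|[|[|U]]]] //; lia.
have [er eu] : r = 3 /\ u = 1.
  case/orP: hr => [/andP[/eqP er u3]|/eqP er]; move: eU; rewrite er U3.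
    by rewrite mul1n => eu; move: u3; rewrite -eu.
  by move=> eu; split=> //; move: eu; clear; lia.
split; last by rewrite ey eu v1.
by apply: sqr1; move: eq'; rewrite er U3 v1; clear; lia.
Qed.

(** The power of 2 in x decides. Odd x is impossible; x = 2 x1 and x = 4 x2 with odd cofactor lead
    to [quartic_4_m11_16]. The symmetry x / y -> 8 y / x, which is addition of the 2-torsion point
    (0, 0) on the curve, exchanges these two and reduces x = 8 x3 to the odd case. *)
Lemma quartic_m11_64 x y z : coprime x y -> 0 < x -> 0 < y ->
  x ^ 4 + 64 * y ^ 4 = z ^ 2 + 11 * x ^ 2 * y ^ 2 -> x = 2 /\ y = 1 \/ x = 4 /\ y = 1.
Proof.
have odd_odd u v w : odd u -> odd v -> u ^ 4 + 64 * v ^ 4 = w ^ 2 + 11 * u ^ 2 * v ^ 2 -> False.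
  move=> oddu oddv; have [i ei] := sqr_mod8 oddu; have [j ej] := sqr_mod8 oddv.
  rewrite -[4]/(2 * 2) !expnM ei ej => e.
  have [k ek] : exists k, w = 2 * k.
    apply: evenE; move/(congr1 odd): e; rewrite !(oddD, oddX, oddM) /=.
    by case: odd.
  by move: e; rewrite ek expnMn; move: (k ^ 2) => k2; clear; lia.
have odd_even u v w : odd u -> ~~ odd v -> 0 < v -> coprime u v ->
    u ^ 4 + 64 * v ^ 4 = w ^ 2 + 11 * u ^ 2 * v ^ 2 -> False.
  move=> oddu /evenE[v' ev] v_gt0 cop e; rewrite ev in v_gt0 cop e.
  apply: (@quartic_m11_64_odd_even u v' w) => //; first by case: (v') v_gt0.
  by apply: (eq_comb (esym e)); ring.
have half a b w : 4 * a = w ^ 2 + 4 * b -> exists w', w = 2 * w' /\ a = w' ^ 2 + b.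
  move=> e; have [w' ew] : exists w', w = 2 * w'.
    by apply: evenE; move/(congr1 odd): e; rewrite !(oddD, oddX, oddM) /=; case: odd.
  by exists w'; split=> //; move: e; rewrite ew expnMn; move: (w' ^ 2) => k; clear; lia.
move=> cop x_gt0 y_gt0 e.
case: (boolP (odd x)) => [oddx|/evenE[x1 ex]].
  by case: (boolP (odd y)) => [oddy|evy]; [case: (odd_odd x y z) | case: (odd_even x y z)].
have oddy : odd y.
  by apply/negPn/negP => evy; apply: (coprime_no_prime (p := 2)) cop _ _; rewrite ?dvdn2 // ex oddM.
rewrite ex in cop x_gt0 e.
have copx1 : coprime x1 y by move: cop; rewrite coprimeMl => /andP[].
have x1_gt0 : 0 < x1 by case: (x1) x_gt0.
have [|z1 [_ e1]] := half (4 * x1 ^ 4 + 16 * y ^ 4) (11 * x1 ^ 2 * y ^ 2) z.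
  by apply: (eq_comb (esym e)); ring.
case: (boolP (odd x1)) => [oddx1|/evenE[x2 ex1]].
  by have [x11 y1] := quartic_4_m11_16 oddx1 oddy copx1 e1; left; rewrite ex x11.
rewrite ex1 in copx1 x1_gt0 e1.
have copx2 : coprime x2 y by move: copx1; rewrite coprimeMl => /andP[].
have x2_gt0 : 0 < x2 by case: (x2) x1_gt0.
have [|z2 [_ e2]] := half (16 * x2 ^ 4 + 4 * y ^ 4) (11 * x2 ^ 2 * y ^ 2) z1.
  by apply: (eq_comb (esym e1)); ring.
rewrite coprime_sym in copx2.
case: (boolP (odd x2)) => [oddx2|/evenE[x3 ex2]].
  have [|y1 x21] := @quartic_4_m11_16 y x2 z2 oddy oddx2 copx2.
    by apply: (eq_comb (esym e2)); ring.
  by right; rewrite ex ex1 x21 y1.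
rewrite ex2 in copx2 x2_gt0 e2.
have copx3 : coprime y x3 by move: copx2; rewrite coprimeMr => /andP[].
have x3_gt0 : 0 < x3 by case: (x3) x2_gt0.
have [|z3 [_ e3]] := half (64 * x3 ^ 4 + y ^ 4) (11 * x3 ^ 2 * y ^ 2) z2.
  by apply: (eq_comb (esym e2)); ring.
have e3' : y ^ 4 + 64 * x3 ^ 4 = z3 ^ 2 + 11 * y ^ 2 * x3 ^ 2.
  by apply: (eq_comb (esym e3)); ring.
by case: (boolP (odd x3)) => [oddx3|evx3]; [case: (odd_odd y x3 z3) | case: (odd_even y x3 z3)].
Qed.

(** * Rational points *)

Import Order.TTheory GRing.Theory Num.Theory.

Local Open Scope ring_scope.

Lemma rat_sqr_nat (s : rat) (n : nat) : s ^+ 2 = n%:R -> exists k : nat, n = (k ^ 2)%N.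
Proof.
move=> e; have d0 : (denq s)%:~R != 0 :> rat by rewrite intr_eq0 denq_neq0.
have /(congr1 absz) : numq s ^+ 2 = n%:Z * denq s ^+ 2.
  apply: (@intr_inj rat); rewrite rmorphXn [RHS]rmorphM rmorphXn /= -[n%:Z%:~R]/(n%:R) -e.
  by rewrite -{2}(divq_num_den s) exprMn exprVn mulfVK // expf_neq0.
rewrite abszM !abszX absz_nat => e'.
have cop := coprime_num_den s.
have : (`|denq s| ^ 2 %| `|numq s| ^ 2)%N by rewrite e' dvdn_mull.
rewrite dvdn_pexp2r // => dv; have d1 : `|denq s|%N = 1%N.
  by apply/eqP; rewrite -dvdn1 -(eqnP cop) dvdn_gcd dv dvdnn.
by exists `|numq s|%N; rewrite e' d1 muln1.
Qed.

Lemma pos_rat_fraction (r : rat) : 0 < r ->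
  exists m n : nat, [/\ (0 < m)%N, (0 < n)%N, coprime m n & r = m%:R / n%:R].
Proof.
move=> r_gt0; exists `|numq r|%N, `|denq r|%N; split.
- by rewrite absz_gt0 numq_eq0 gt_eqF.
- by rewrite absz_gt0 denq_neq0.
- exact: coprime_num_den.
rewrite -{1}(divq_num_den r) -![_%:R]/(_%:Z%:~R) !gez0_abs //.
by rewrite ltW // numq_gt0.
Qed.

Lemma sqr_eq1_norm (t : rat) : `|t| = 1 -> t ^+ 2 = 1.
Proof. by move=> e; rewrite -real_normK ?num_real // e expr1n. Qed.

Lemma rat_fourth_powers (t z : rat) : t != 0 -> t ^+ 4 + 1 = 2 * z ^+ 2 -> t ^+ 2 = 1.
Proof.
move=> t0 e; have [|m [n [m0 n0 cop et]]] := @pos_rat_fraction `|t|; first by rewrite normr_gt0.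
have e4 : `|t| ^+ 4 = t ^+ 4 by rewrite -[4%N]/(2 * 2)%N !exprM real_normK ?num_real.
have nz : n%:R != 0 :> rat by rewrite pnatr_eq0 -lt0n.
have [|k ek] := @rat_sqr_nat (2 * z * n%:R ^+ 2) (2 * (m ^ 4 + n ^ 4)).
  rewrite natrM natrD !natrX.
  have -> : (2 * z * n%:R ^+ 2) ^+ 2 = 2 * (2 * z ^+ 2) * n%:R ^+ 4 by ring.
  by rewrite -e -e4 et; field.
have [l el] : exists l, k = (2 * l)%N.
  by apply: evenE; move/(congr1 odd): ek; rewrite oddM oddX /= => <-.
have e' : (m ^ 4 + n ^ 4 = 2 * l ^ 2)%N by move: ek; rewrite el expnMn; move: (l ^ 2)%N (m ^ 4)%N (n ^ 4)%N; clear; lia.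
apply: sqr_eq1_norm; rewrite et.
suff -> : m = n by rewrite divff.
case/orP: (leq_total n m) => le; first exact: sum_fourth_powers e'.
by symmetry; apply: (@sum_fourth_powers n m l); rewrite 1?coprime_sym // addnC.
Qed.

(** Rests on (x + 1)^4 + (x - 1)^4 = 2 (x^4 + 6 x^2 + 1). *)
Lemma rat_quartic_1_6_1 (x y : rat) : x != 1 -> x != -1 ->
  x ^+ 4 + 6 * x ^+ 2 + 1 = y ^+ 2 -> x = 0.
Proof.
rewrite -subr_eq0 -addr_eq0 => x1 x2 e.
have t0 : (x + 1) / (x - 1) != 0 by rewrite mulf_neq0 ?invr_eq0.
have e4 : ((x + 1) / (x - 1)) ^+ 4 + 1 = 2 * (y / (x - 1) ^+ 2) ^+ 2.
  have -> : (y / (x - 1) ^+ 2) ^+ 2 = y ^+ 2 / (x - 1) ^+ 4 by field.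
  by rewrite -e; field.
have h := rat_fourth_powers t0 e4.
have : (x + 1) ^+ 2 = ((x + 1) / (x - 1)) ^+ 2 * (x - 1) ^+ 2 by field.
by rewrite h mul1r => h'; lra.
Qed.

Lemma rat_quartic_1_m1_1 (t z : rat) : t != 0 ->
  t ^+ 4 - t ^+ 2 + 1 = z ^+ 2 -> t ^+ 2 = 1.
Proof.
move=> t0 e; have [|m [n [m0 n0 cop et]]] := @pos_rat_fraction `|t|; first by rewrite normr_gt0.
have e2 : `|t| ^+ 2 = t ^+ 2 by rewrite real_normK ?num_real.
have nz : n%:R != 0 :> rat by rewrite pnatr_eq0 -lt0n.
have le : (m ^ 2 * n ^ 2 <= m ^ 4 + n ^ 4)%N.
  rewrite -[4%N]/(2 * 2)%N !expnM; apply: leq_trans (nat_Cauchy _ _).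
  by rewrite leq_pmull.
have [|k ek] := @rat_sqr_nat (z * n%:R ^+ 2) (m ^ 4 + n ^ 4 - m ^ 2 * n ^ 2).
  rewrite natrB // natrM natrD !natrX exprMn -e.
  have -> : t ^+ 4 = (t ^+ 2) ^+ 2 by rewrite -exprM.
  by rewrite -e2 et; field.
apply: sqr_eq1_norm; rewrite et.
suff -> : m = n by rewrite divff.
by apply: (@quartic_m1_1 m n k) => //; rewrite -ek subnK.
Qed.

(** Rests on (x + 1)^4 - (x + 1)^2 (x - 1)^2 + (x - 1)^4 = x^4 + 14 x^2 + 1. *)
Lemma rat_quartic_1_14_1 (x y : rat) : x != 1 -> x != -1 ->
  x ^+ 4 + 14 * x ^+ 2 + 1 = y ^+ 2 -> x = 0.
Proof.
rewrite -subr_eq0 -addr_eq0 => x1 x2 e.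
have t0 : (x + 1) / (x - 1) != 0 by rewrite mulf_neq0 ?invr_eq0.
have h : ((x + 1) / (x - 1)) ^+ 2 = 1.
  apply: (@rat_quartic_1_m1_1 _ (y / (x - 1) ^+ 2) t0).
  have -> : (y / (x - 1) ^+ 2) ^+ 2 = y ^+ 2 / (x - 1) ^+ 4 by field.
  by rewrite -e; field.
have : (x + 1) ^+ 2 = ((x + 1) / (x - 1)) ^+ 2 * (x - 1) ^+ 2 by field.
by rewrite h mul1r => h'; lra.
Qed.

Lemma cubic_pos_squares (m n k N : nat) : coprime m n -> coprime (m * n) N ->
  (m * n * N = k ^ 2)%N -> exists u v w, [/\ m = u ^ 2, n = v ^ 2, N = w ^ 2 & coprime u v]%N.
Proof.
move=> cop copN e; have [l [w [el ew _ _]]] := coprime_mul_exp (k := 2) isT copN e.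
by have [u [v [eu ev _ copuv]]] := coprime_mul_exp (k := 2) isT cop el; exists u, v, w.
Qed.

(* The lemmas [rat_cubic_N] find the rational points of an elliptic curve of
   conductor N and rank 0. *)
Lemma rat_cubic_24 (x y : rat) : x != 0 -> y ^+ 2 = x * (x ^+ 2 - x + 1) -> x = 1.
Proof.
move=> x0 e; have x_gt0 : 0 < x.
  rewrite lt_def x0 /= -(@pmulr_lge0 _ (x ^+ 2 - x + 1)) -?e ?sqr_ge0 //.
  by have := sqr_ge0 (2 * x - 1); nra.
have [m [n [m0 n0 cop ex]]] := pos_rat_fraction x_gt0.
have nz : n%:R != 0 :> rat by rewrite pnatr_eq0 -lt0n.
have le : (m * n <= m ^ 2 + n ^ 2)%N.
  by apply: leq_trans (nat_Cauchy _ _); rewrite leq_pmull.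
set N := (m ^ 2 + n ^ 2 - m * n)%N.
have eN : (N + m * n = m ^ 2 + n ^ 2)%N by rewrite subnK.
have [|k ek] := @rat_sqr_nat (y * n%:R ^+ 2) (m * n * N).
  rewrite exprMn e ex !natrM natrB // natrM natrD !natrX; field.
  exact: nz.
have copN : coprime (m * n) N.
  rewrite coprime_sym; apply: coprime_primeP => [|p p_pr pN]; first by rewrite muln_gt0 m0.
  have pS : (p %| m * n -> p %| m ^ 2 + n ^ 2)%N by move=> pmn; rewrite -eN dvdn_add.
  move=> pmn; move: (pS pmn) (pmn); rewrite Euclid_dvdM // => pS' /orP[pm|pn].
    apply: (coprime_no_prime p_pr cop pm); apply: (prime_dvdX (k := 2)) => //.
    by move: pS'; rewrite dvdn_addr // expnS dvdn_mulr.
  apply: (coprime_no_prime p_pr cop _ pn); apply: (prime_dvdX (k := 2)) => //.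
  by move: pS'; rewrite dvdn_addl // expnS dvdn_mulr.
have [u [v [w [eu ev ew copuv]]]] := cubic_pos_squares cop copN ek.
have [u0 v0] : (0 < u)%N /\ (0 < v)%N.
  by move: m0 n0; rewrite eu ev !expn_gt0 !orbF.
have -> : x = 1; last by [].
rewrite ex eu ev (@quartic_m1_1 u v w) ?divff //; first by rewrite -ev.
by move: eN; rewrite eu ev ew -!expnM => <-.
Qed.

Lemma nat_cubic_20 (m n k N : nat) : (0 < m)%N -> (0 < n)%N -> coprime m n ->
  (m * n * N = k ^ 2)%N -> (N + n ^ 2 = m ^ 2 + m * n)%N -> m = 1%N /\ n = 1%N.
Proof.
move=> m0 n0 cop ek eN.
have copN : coprime (m * n) N.
  rewrite coprime_sym; apply: coprime_primeP => [|p p_pr pN]; first by rewrite muln_gt0 m0.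
  rewrite Euclid_dvdM // => /orP[pm|pn].
    apply: (coprime_no_prime p_pr cop pm); apply: (prime_dvdX (k := 2)) => //.
    by rewrite -(dvdn_addr _ pN) eN dvdn_add // ?dvdn_mulr // expnS dvdn_mulr.
  apply: (coprime_no_prime p_pr cop _ pn); apply: (prime_dvdX (k := 2)) => //.
  have pmn : (p %| m * n)%N by rewrite dvdn_mull.
  by rewrite -(dvdn_addl _ pmn) -eN dvdn_add // expnS dvdn_mulr.
have [u [v [w [eu ev ew copuv]]]] := cubic_pos_squares cop copN ek.
have [u0 v0] : (0 < u)%N /\ (0 < v)%N.
  by move: m0 n0; rewrite eu ev !expn_gt0 !orbF.
have [|u1 v1] := @quartic_1_m1 u v w copuv u0 v0; last by rewrite eu ev u1 v1.
by move: eN; rewrite eu ev ew -!expnM addnC => ->.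
Qed.

Lemma rat_cubic_20 (x y : rat) : x != 0 -> y ^+ 2 = x ^+ 3 + x ^+ 2 - x -> x = 1 \/ x = -1.
Proof.
move=> x0 e; case: (ltP 0 x) => [x_gt0|x_le0].
  left; have [m [n [m0 n0 cop ex]]] := pos_rat_fraction x_gt0.
  have nz : n%:R != 0 :> rat by rewrite pnatr_eq0 -lt0n.
  have es : (y * n%:R ^+ 2) ^+ 2 = m%:R * n%:R * (m%:R ^+ 2 + m%:R * n%:R - n%:R ^+ 2).
    by rewrite exprMn e ex; field.
  have le : (n ^ 2 <= m ^ 2 + m * n)%N.
    rewrite -(ler_nat rat) natrD natrM !natrX -subr_ge0.
    rewrite -(@pmulr_rge0 _ (m%:R * n%:R)) -?es ?sqr_ge0 //.
    by rewrite mulr_gt0 ?ltr0n.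
  have [|k ek] := @rat_sqr_nat (y * n%:R ^+ 2) (m * n * (m ^ 2 + m * n - n ^ 2)).
    by rewrite es !natrM natrB // natrD natrM !natrX.
  have [m1 n1] := nat_cubic_20 m0 n0 cop ek (subnK le).
  by rewrite ex m1 n1 divff.
(* Adding the 2-torsion point (0, 0) sends x to -1/x. So -x is written as n/m, with the roles of m
   and n exchanged, and the same equation in [nat] appears. *)
right; have nx_gt0 : 0 < - x by rewrite oppr_gt0 lt_def eq_sym x0.
have [n [m [n0 m0 cop ex]]] := pos_rat_fraction nx_gt0.
have mz : m%:R != 0 :> rat by rewrite pnatr_eq0 -lt0n.
have {}ex : x = - (n%:R / m%:R) by rewrite -ex opprK.
have es : (y * m%:R ^+ 2) ^+ 2 = m%:R * n%:R * (m%:R ^+ 2 + m%:R * n%:R - n%:R ^+ 2).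
  by rewrite exprMn e ex; field.
have le : (n ^ 2 <= m ^ 2 + m * n)%N.
  rewrite -(ler_nat rat) natrD natrM !natrX -subr_ge0.
  rewrite -(@pmulr_rge0 _ (m%:R * n%:R)) -?es ?sqr_ge0 //.
  by rewrite mulr_gt0 ?ltr0n.
have [|k ek] := @rat_sqr_nat (y * m%:R ^+ 2) (m * n * (m ^ 2 + m * n - n ^ 2)).
  by rewrite es !natrM natrB // natrD natrM !natrX.
rewrite coprime_sym in cop.
have [m1 n1] := nat_cubic_20 m0 n0 cop ek (subnK le).
by rewrite ex m1 n1 divff.
Qed.

(** Induction on m: removing a common factor 2 exchanges the two alternatives, and the coprime case
    falls under the first. *)
Lemma mul_eq_square_gcd2 (m N k : nat) : (0 < m)%N -> (0 < N)%N ->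
  (forall p, prime p -> p %| m -> p %| N -> p = 2)%N -> (m * N = k ^ 2)%N ->
  exists u w, (m = u ^ 2 /\ N = w ^ 2 \/ m = 2 * u ^ 2 /\ N = 2 * w ^ 2)%N.
Proof.
have [B] := ubnP m; elim: B m N k => // B IHB m N k lt m0 N0 np e.
case: (boolP ((2 %| m) && (2 %| N))%N) => [/andP[/dvdnP[m' em] /dvdnP[N' eN]]|n2].
  have [k' ek] : exists k', k = (2 * k')%N.
    by apply: evenE; move/(congr1 odd): e; rewrite em !(oddX, oddM) /= !andbF => <-.
  have e' : (m' * N' = k' ^ 2)%N.
    apply/eqP; rewrite -(eqn_pmul2l (isT : 0 < 4)%N); apply/eqP.
    by apply: (eq_comb (esym e)); rewrite em eN ek; ring.
  have [|||||u [w [[eu ew]|[eu ew]]]] := IHB m' N' k'.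
  - by move: lt m0; rewrite em; clear; lia.
  - by move: m0; rewrite em; case: (m').
  - by move: N0; rewrite eN; case: (N').
  - by move=> p p_pr pm pN; apply: np => //; rewrite ?em ?eN dvdn_mulr.
  - exact: e'.
  - by exists u, w; right; rewrite em eN eu ew !(mulnC _ 2).
  - by exists (2 * u)%N, (2 * w)%N; left; rewrite em eN eu ew; split; ring.
have cop : coprime m N.
  apply: coprime_primeP => // p p_pr pm pN; have p2 := np p p_pr pm pN.
  by case/negP: n2; rewrite -p2 pm.
by have [u [w [eu ew _ _]]] := coprime_mul_exp (k := 2) isT cop e; exists u, w; left.
Qed.

Lemma rat_cubic_30 (x y : rat) : x != 0 -> y ^+ 2 = x * (x ^+ 2 - 11 * x + 64) ->
  x = 4 \/ x = 16.
Proof.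
move=> x0 e; have x_gt0 : 0 < x.
  rewrite lt_def x0 /= -(@pmulr_lge0 _ (x ^+ 2 - 11 * x + 64)) -?e ?sqr_ge0 //.
  by have := sqr_ge0 (2 * x - 11); nra.
have [m [n [m0 n0 cop ex]]] := pos_rat_fraction x_gt0.
have nz : n%:R != 0 :> rat by rewrite pnatr_eq0 -lt0n.
have lt : (11 * m * n < m ^ 2 + 64 * n ^ 2)%N.
  have mn0 : (0 < m * n)%N by rewrite muln_gt0 m0.
  have h := nat_Cauchy m (8 * n); rewrite expnMn in h.
  apply: leq_trans h; rewrite (_ : 2 * _ = 16 * (m * n))%N; last by ring.
  by rewrite -mulnA; move: (m * n)%N mn0; clear; lia.
set N := (m ^ 2 + 64 * n ^ 2 - 11 * m * n)%N.
have eN : (N + 11 * m * n = m ^ 2 + 64 * n ^ 2)%N by rewrite subnK // ltnW.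
have N0 : (0 < N)%N by rewrite subn_gt0.
have [|k ek] := @rat_sqr_nat (y * n%:R ^+ 2) (m * N * n).
  rewrite exprMn e ex !natrM natrB ?(ltnW lt) // natrD !natrM ?natrX; field.
  exact: nz.
have copn : coprime (m * N) n.
  apply: coprime_primeP => // p p_pr pmN pn.
  apply: (coprime_no_prime p_pr cop _ pn); move: pmN.
  rewrite Euclid_dvdM // => /orP[//|pN]; apply: (prime_dvdX (k := 2)) => //.
  have pn2 : (p %| 64 * n ^ 2)%N by rewrite dvdn_mull // expnS dvdn_mulr.
  by rewrite -(dvdn_addl _ pn2) -eN dvdn_add // dvdn_mull.
have [l [v [el ev _ _]]] := coprime_mul_exp (k := 2) isT copn ek.
have [|u [w euw]] := mul_eq_square_gcd2 m0 N0 _ el.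
  move=> p p_pr pm pN; have pm2 : (p %| m ^ 2)%N by rewrite expnS dvdn_mulr.
  have : (p %| 2 ^ 6 * n ^ 2)%N.
    by rewrite -(dvdn_addr _ pm2) -[(2 ^ 6)%N]/64%N -eN dvdn_add // dvdn_mulr // dvdn_mull.
  rewrite Euclid_dvdM // => /orP[/(prime_dvdX p_pr)|/(prime_dvdX p_pr) pn].
    by rewrite dvdn_prime2 // => /eqP.
  by case: (coprime_no_prime p_pr cop pm pn).
have v0 : (0 < v)%N by move: n0; rewrite ev expn_gt0 orbF.
case: euw => [[eu ew]|[eu ew]].
  have u0 : (0 < u)%N by move: m0; rewrite eu expn_gt0 orbF.
  have copuv : coprime u v by move: cop; rewrite eu ev coprime_pexpl // coprime_pexpr.
  have [|[u1 v1]|[u1 v1]] := @quartic_m11_64 u v w copuv u0 v0.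
  - by move: eN; rewrite eu ev ew -!expnM => <-.
  - by left; rewrite ex eu ev u1 v1.
  - by right; rewrite ex eu ev u1 v1.
(* The class with factors 2 u^2 and 2 w^2 has no solution modulo 3, unless 3 divides both u and
   v. *)
exfalso; have e2 : (w ^ 2 + 11 * u ^ 2 * v ^ 2 = 2 * u ^ 4 + 32 * v ^ 4)%N.
  apply/eqP; rewrite -(eqn_pmul2l (isT : 0 < 2)%N); apply/eqP.
  by apply: (eq_comb (esym eN)); rewrite eu ev ew; ring.
have copuv : coprime u v.
  by move: cop; rewrite eu ev coprime_pexpr // coprimeMl coprime_pexpl // => /andP[].
have mod3 a : exists i, (a ^ 2 = 3 * i /\ (3 %| a) \/ a ^ 2 = 3 * i + 1)%N.
  case: (boolP (3 %| a)%N) => [a3|/sqr_mod3[i ->]]; last by exists i; right.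
  by case/dvdnP: (a3) => i ei; exists (3 * i ^ 2)%N; left; split=> //; rewrite ei; ring.
have [i hi] := mod3 u; have [j hj] := mod3 v; have [h hh] := mod3 w.
move: e2; rewrite -[4%N]/(2 * 2)%N !expnM.
case: hi => [[-> u3]|->]; case: hj => [[-> v3]|->]; first by case: (coprime_no_prime (p := 3) isT copuv u3 v3).
all: by case: hh => [[-> _]|->]; clear; lia.
Qed.

(** * Dynamics of the maps f_a *)

Local Arguments fa : simpl never.

Lemma rat_sqr_neq3 (r : rat) : r ^+ 2 != 3.
Proof.
apply/eqP => /(@rat_sqr_nat r 3)[[|[|k]]] //; rewrite -mulnn; clear; lia.
Qed.

Lemma lin_comb (R : pzRingType) (c a b m n : R) : a = b -> m + c * a = n + c * b -> m = n.
Proof. by move=> ->; apply: addIr. Qed.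

(* f_a(z) = w with the denominator cleared; for a <> 1, -1 this is equivalent
   to [fa a (pt z) = pt w], see [fa_pt]. *)
Definition maps (a z w : rat) := a * z ^+ 2 + 1 = w * (z ^+ 3 + a * z).

Lemma maps_neq0 a z w : maps a z w -> z != 0.
Proof. by move=> e; apply/eqP => z0; move: e; rewrite /maps z0 => e; lra. Qed.

Lemma maps_opp a z w : maps a z w -> maps a (- z) (- w).
Proof. by rewrite /maps => e; rewrite sqrrN e; ring. Qed.

(** * Cycles of length at most three and second preimages *)

Lemma maps_fixed a z : maps a z z -> z = 1 \/ z = -1.
Proof.
move=> e; have : (z - 1) * (z + 1) * (z ^+ 2 + 1) = 0.
  by apply: (lin_comb (c := 1) e); ring.
have z2 : z ^+ 2 + 1 != 0 by rewrite lt0r_neq0 // ltr_wpDl ?sqr_ge0.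
move/eqP; rewrite !mulf_eq0 (negbTE z2) orbF subr_eq0 addr_eq0.
by case/orP=> /eqP; [left | right].
Qed.

(** In the combination y * (first equation) + x * (second equation) the parameter cancels, leaving
    (x + y) (x^2 y^2 - 1) = 0. The factors x y = 1 and x y = -1 lead to a = 1 and a = -1. *)
Lemma maps_2cycle a x y : a != 1 -> a != -1 -> x != y -> maps a x y -> maps a y x ->
  y = - x /\ x ^+ 4 + 2 * a * x ^+ 2 + 1 = 0.
Proof.
move=> a1 am1 xy exy eyx; have x0 := maps_neq0 exy; have y0 := maps_neq0 eyx.
have : (x + y) * (x * y - 1) * (x * y + 1) = 0.
  by apply: (lin_comb (c := y) exy); apply: (lin_comb (c := x) eyx); ring.
move/eqP; rewrite !mulf_eq0 subr_eq0 !addr_eq0 -orbA => /or3P[] /eqP h.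
- have ey : y = - x by rewrite h opprK.
  split=> //; move: exy; rewrite ey /maps => exy.
  by apply: (lin_comb (c := -1) exy); ring.
- have : (a - 1) * (x - y) = 0.
    apply: (mulfI x0); apply: (lin_comb (c := -1) exy).
    by apply: (lin_comb (c := - (x ^+ 2 + 1)) h); ring.
  by move/eqP; rewrite mulf_eq0 !subr_eq0 (negbTE a1) (negbTE xy).
- have /eqP : (a + 1) * (x ^+ 2 + 1) = 0.
    apply: (lin_comb (c := -1) exy).
    by apply: (lin_comb (c := - (x ^+ 2 + a)) h); ring.
  have x2 : x ^+ 2 + 1 != 0 by rewrite lt0r_neq0 // ltr_wpDl ?sqr_ge0.
  by rewrite mulf_eq0 (negbTE x2) orbF addr_eq0 (negbTE am1).
Qed.

(* Modulo rotation, a 3-cycle is given by the elementary symmetric functions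
   e1, e2, v of its points.  With u = e1 v and s = v^4 the relations v P = e2 and
   Q = v^2 e1 amount to the equation R3, quadratic in s, whose discriminant is
   (1 - u) (4 u^2 + 3 u + 9) up to a square: this is the curve of [rat_cubic_30]. *)
Lemma maps_3cycle a x y w : x != y -> y != w -> w != x ->
  maps a x y -> maps a y w -> maps a w x -> False.
Proof.
move=> xy yw wx exy eyw ewx.
have x0 := maps_neq0 exy; have y0 := maps_neq0 eyw; have w0 := maps_neq0 ewx.
rewrite /maps in exy eyw ewx.
set e1 := x + y + w; set e2 := x * y + y * w + w * x; set v := x * y * w.
have v0 : v != 0 by rewrite !mulf_neq0.
set P := x ^+ 2 * y + y ^+ 2 * w + w ^+ 2 * x.
set Q := x * y ^+ 2 + y * w ^+ 2 + w * x ^+ 2.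
(* The multipliers here and for [eQ] are chosen so that a cancels cyclically. *)
have eP : v * P = e2.
  apply: (lin_comb (c := y * w) exy); apply: (lin_comb (c := w * x) eyw).
  by apply: (lin_comb (c := x * y) ewx); rewrite /v /P /e2; ring.
have eQ : Q = v ^+ 2 * e1.
  apply: (lin_comb (c := - (w ^+ 2 * y)) exy); apply: (lin_comb (c := - (x ^+ 2 * w)) eyw).
  by apply: (lin_comb (c := - (y ^+ 2 * x)) ewx); rewrite /v /Q /e1; ring.
have ePQ : P + Q = e1 * e2 - 3 * v by rewrite /P /Q /e1 /e2 /v; ring.
have ePMQ : P * Q = e2 ^+ 3 + e1 ^+ 3 * v - 6 * e1 * e2 * v + 9 * v ^+ 2.
  by rewrite /P /Q /e1 /e2 /v; ring.
have eD : P - Q = (y - w) * (w - x) * (x - y) \/ P - Q = - ((y - w) * (w - x) * (x - y)).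
  by (left; rewrite /P /Q; ring) || (right; rewrite /P /Q; ring).
have PQ0 : P - Q != 0.
  by case: eD => ->; rewrite ?oppr_eq0 !mulf_neq0 ?subr_eq0.
clearbody P Q e1 e2 v; clear exy eyw ewx x0 y0 w0 eD xy yw wx.
pose u := e1 * v; pose s := v ^+ 4.
have R1 : e2 * (u - 1) = v ^+ 2 * (u + 3).
  apply: (lin_comb (c := v) ePQ); apply: (lin_comb (c := - v) eQ).
  by apply: (lin_comb (c := -1) eP); rewrite /u; ring.
have u1 : u - 1 != 0.
  apply/eqP => h; move/eqP: R1; rewrite h mulr0 eq_sym mulf_eq0 expf_eq0 (negbTE v0) /=.
  by move/eqP => h'; lra.
have eP' : P * (u - 1) = v * (u + 3).
  by apply: (mulfI v0); apply: (lin_comb (c := u - 1) (esym eP)); apply: (lin_comb (c := -1) R1); ring.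
have eQ' : Q = v * u by rewrite eQ /u; ring.
have ePQD : (P - Q) * (u - 1) = - v * (u - 3) * (u + 1).
  by rewrite mulrBl eP' eQ'; ring.
have u31 : (u - 3) * (u + 1) != 0.
  have : (P - Q) * (u - 1) != 0 by rewrite mulf_neq0.
  by rewrite ePQD -mulrA mulf_eq0 negb_or => /andP[].
have R2 : e2 ^+ 3 + e1 ^+ 3 * v - 7 * u * e2 + 9 * v ^+ 2 = 0.
  apply: (lin_comb (c := 1) ePMQ); rewrite eQ' -eP /u; ring.
have R3 : s ^+ 2 * (u + 3) ^+ 3 + u ^+ 3 * (u - 1) ^+ 3 - s * (u - 1) ^+ 2 * (7 * u ^+ 2 + 12 * u + 9) = 0.
  have -> : s ^+ 2 * (u + 3) ^+ 3 = v ^+ 2 * (v ^+ 2 * (u + 3)) ^+ 3 by rewrite /s; ring.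
  have -> : s * (u - 1) ^+ 2 * (7 * u ^+ 2 + 12 * u + 9) =
     7 * u * v ^+ 2 * (v ^+ 2 * (u + 3)) * (u - 1) ^+ 2 - 9 * v ^+ 4 * (u - 1) ^+ 3 by rewrite /s; ring.
  rewrite -R1; apply: (lin_comb (c := - (v ^+ 2 * (u - 1) ^+ 3)) R2).
  by rewrite /u; ring.
(* [N] is the derivative of the quadratic [R3] in s, so its square is the discriminant. *)
pose N := 2 * s * (u + 3) ^+ 3 - (u - 1) ^+ 2 * (7 * u ^+ 2 + 12 * u + 9).
have eN : N ^+ 2 = (1 - u) * (4 * u ^+ 2 + 3 * u + 9) * ((u - 1) * ((u - 3) * (u + 1))) ^+ 2.
  by apply: (lin_comb (c := - (4 * (u + 3) ^+ 3)) R3); rewrite /N; ring.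
have c0 : (u - 1) * ((u - 3) * (u + 1)) != 0 by rewrite mulf_neq0.
set c := (u - 1) * _ in c0 eN.
have s0 : s != 0 by rewrite expf_neq0.
(* With X = 4 - 4 u, the product X (X^2 - 11 X + 64) equals 16 (1 - u) (4 u^2 + 3 u + 9). *)
have [||h|h] := @rat_cubic_30 (4 - 4 * u) (4 * N / c).
- by apply: contraNneq u1 => h; apply/eqP; lra.
- have -> : (4 * N / c) ^+ 2 = 16 * (N ^+ 2 / c ^+ 2) by field.
  by rewrite eN mulfK ?expf_neq0 //; ring.
(* X = 4 gives u = 0 and v^4 = 1/3; X = 16 gives u = -3 and v^4 = 3. Both make 3 a rational
   square. *)
- have u0 : u = 0 by lra.
  case/eqP: (rat_sqr_neq3 (3 * v ^+ 2)); apply: (mulfI s0).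
  by apply: (lin_comb (c := - 3^-1) R3); rewrite u0 /s; field.
- have u3 : u = - 3 by lra.
  case/eqP: (rat_sqr_neq3 (v ^+ 2)); apply: (mulfI (_ : 576 != 0 :> rat)); first by rewrite pnatr_eq0.
  by apply: (lin_comb (c := 1) R3); rewrite u3 /s; ring.
Qed.

(* In the coordinate (z - 1) / (z + 1) the fixed point 1 moves to 0, and the
   product of the coordinates of t and w is an abscissa on the curve of
   [rat_cubic_20]. *)
Lemma maps_preimage1 a t w : a != -1 -> t != 1 ->
  t ^+ 2 + (1 - a) * t + 1 = 0 -> maps a w t -> False.
Proof.
move=> am1 t1 et e; have w0 := maps_neq0 e.
have a1 : a + 1 != 0 by rewrite addr_eq0.
have tm1 : t + 1 != 0.
  apply: contraNneq a1 => h; have {}h : t = -1 by lra.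
  by apply/eqP; move: et; rewrite h; lra.
have t0 : t != 0 by apply: contraTneq isT => h; move: et; rewrite h; lra.
have wm1 : w + 1 != 0.
  apply/eqP => h; have ew : w = -1 by lra.
  have : (a + 1) * (t + 1) = 0 by apply: (lin_comb (c := -1) e); rewrite ew; ring.
  by move/eqP; rewrite mulf_eq0 (negbTE a1) (negbTE tm1).
have ea : a = (t ^+ 2 + t + 1) / t by apply: (mulIf t0); rewrite mulfVK //; apply: (lin_comb (c := 1) et); ring.
pose al := (t - 1) / (t + 1); pose be := (w - 1) / (w + 1).
have al0 : al != 0 by rewrite mulf_neq0 ?invr_eq0 // subr_eq0.
have main : be * (al ^+ 2 - be ^+ 2) = al * (1 - al ^+ 2 * be ^+ 2).
  apply: (mulfI (_ : (t + 1) ^+ 3 * (w + 1) ^+ 3 != 0)); first by rewrite mulf_neq0 ?expf_neq0.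
  apply: (lin_comb (c := - 8 * t) e); rewrite /al /be ea; field.
  by rewrite ?t0 ?tm1 ?wm1.
have [be0|be0] := eqVneq be 0.
  move: main; rewrite be0 mul0r expr0n /= mulr0 subr0 mulr1 => h.
  by rewrite -h eqxx in al0.
have E : (be ^+ 2) ^+ 2 = (al * be) ^+ 3 + (al * be) ^+ 2 - al * be.
  by apply: (lin_comb (c := be) main); ring.
have be4 : (be ^+ 2) ^+ 2 = 1.
  by case: (rat_cubic_20 (mulf_neq0 al0 be0) E) => h; rewrite E h; ring.
have be2 : be ^+ 2 = 1.
  have b2 : be ^+ 2 + 1 != 0 by rewrite lt0r_neq0 // ltr_wpDl ?sqr_ge0.
  by apply/eqP; rewrite -subr_eq0; apply/eqP/(mulIf b2); apply: (lin_comb (c := -1) be4); ring.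
have : be ^+ 2 * (w + 1) ^+ 2 = (w - 1) ^+ 2 by rewrite /be; field.
by rewrite be2 => h; case/eqP: w0; lra.
Qed.

(** With a = -t^2 and X = w / t the equation becomes X^3 + X^2 - X = 1 / t^4, a point with ordinate
    1 / t^2. Its abscissa is 1 or -1, so t^4 = 1 and a = -1. *)
Lemma maps_preimage_infty a t w : a != -1 -> t ^+ 2 + a = 0 -> maps a w t -> False.
Proof.
move=> am1 et e; have w0 := maps_neq0 e.
have ea : a = - t ^+ 2 by apply: (lin_comb (c := -1) et); ring.
have t0 : t != 0.
  apply: contraTneq isT => h; move: e; rewrite /maps ea h; lra.
have e4 : w / t * ((w / t) ^+ 2 + w / t - 1) * t ^+ 4 = 1.
  move: e; rewrite /maps ea => e.
  by apply: (lin_comb (c := 1) e); field.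
have : t ^+ 4 = 1.
  have [||h|h] := @rat_cubic_20 (w / t) (1 / t ^+ 2).
  - by rewrite mulf_neq0 ?invr_eq0.
  - apply: (mulIf (_ : t ^+ 4 != 0)); first by rewrite expf_neq0.
    apply: (lin_comb (c := 1) e4); field => //.
  - by rewrite h in e4; lra.
  - by rewrite h in e4; lra.
move=> t4; have : (t ^+ 2 - 1) * (t ^+ 2 + 1) = 0 by apply: (lin_comb (c := -1) t4); ring.
have t2 : t ^+ 2 + 1 != 0 by rewrite lt0r_neq0 // ltr_wpDl ?sqr_ge0.
move/eqP; rewrite mulf_eq0 (negbTE t2) orbF => /eqP h.
by case/eqP: am1; rewrite ea; lra.
Qed.

(** Conjugation by z -> 1/z reduces this to preimages of oo. *)
Lemma maps_preimage0 a t w : a != -1 -> a * t ^+ 2 + 1 = 0 -> maps a w t -> False.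
Proof.
move=> am1 et e; have w0 := maps_neq0 e.
have t0 : t != 0 by apply: contraTneq isT => h; move: et; rewrite h; lra.
have tV : t^-1 != 0 by rewrite invr_eq0.
have wV : w^-1 != 0 by rewrite invr_eq0.
apply: (@maps_preimage_infty a t^-1 w^-1) => //.
  by apply: (mulfI (_ : t ^+ 2 != 0)); [rewrite expf_neq0 | apply: (lin_comb (c := -1) et); field].
rewrite /maps; apply: (mulfI (_ : t * w ^+ 3 != 0)); first by rewrite mulf_neq0 ?expf_neq0.
apply: (lin_comb (c := 1) e); field; exact/andP.
Qed.

(** Dividing out the known preimage -t leaves a quadratic in w. Its discriminant is, up to squares,
    t^8 + 14 t^4 + 1, a value of the conductor 24 quartic at t^2. *)
Lemma maps_preimage_2cycle a t w : a != -1 ->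
  t ^+ 4 + 2 * a * t ^+ 2 + 1 = 0 -> maps a w t -> w = - t.
Proof.
move=> am1 et e; have w0 := maps_neq0 e.
have t0 : t != 0 by apply: contraTneq isT => h; move: et; rewrite h; lra.
have ea : a = - (t ^+ 4 + 1) / (2 * t ^+ 2).
  apply: (mulIf (_ : 2 * t ^+ 2 != 0)); first by rewrite mulf_neq0 ?expf_neq0.
  by rewrite mulfVK ?mulf_neq0 ?expf_neq0 //; apply: (lin_comb (c := -1) et); ring.
apply/eqP; rewrite -addr_eq0; apply/negPn/negP => wt.
have q : t ^+ 2 * w ^+ 2 - t * (a + t ^+ 2) * w - 1 = 0.
  apply: (mulfI wt); rewrite mulr0.
  move: e; rewrite /maps ea => e.
  by apply: (lin_comb (c := t) e); field.
have t2 : t ^+ 2 + 1 != 0 by rewrite lt0r_neq0 // ltr_wpDl ?sqr_ge0.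
have : t ^+ 2 = 0.
  apply: (@rat_quartic_1_14_1 (t ^+ 2) (2 * t ^+ 2 * (2 * t * w - (a + t ^+ 2)))).
  - apply: contraNneq am1 => h; rewrite ea.
    have -> : t ^+ 4 = (t ^+ 2) ^+ 2 by ring.
    by rewrite h.
  - by rewrite -addr_eq0.
  - apply: (lin_comb (c := 16 * t ^+ 4) q); rewrite ea; field => //.
by move/eqP; rewrite expf_eq0 (negbTE t0).
Qed.

(** * Mutual exclusion of the three families *)

Lemma preimage1_preimage_infty (a t s : rat) : a != -1 ->
  t ^+ 2 + (1 - a) * t + 1 = 0 -> s ^+ 2 + a = 0 -> False.
Proof.
move=> am1 et es; have t0 : t != 0 by apply/eqP => h; move: et; rewrite h; clear; lra.
have nt0 : - t != 0 by rewrite oppr_eq0.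
have ea : a = - s ^+ 2 by apply: (lin_comb (c := -1) es); ring.
have h : - t = 1.
  (* Substituting a = -s^2 and X = -t gives (s X)^2 = X (X^2 - X + 1); the point X = 1 means a =
     -1. *)
  apply: (@rat_cubic_24 _ (s * t) nt0).
  by apply: (lin_comb (c := - t) et); rewrite ea; ring.
have {}h : t = -1 by lra.
by case/eqP: am1; move: et; rewrite h; lra.
Qed.

(** The first equation gives (t - 1)^2 / (t + 1)^2 = (a - 3) / (a + 1), and inserting a = -(s^4 + 1)
    / (2 s^2) turns this into (s^4 + 6 s^2 + 1) / (s^2 - 1)^2. *)
Lemma preimage1_2cycle (a t s : rat) : a != -1 ->
  t ^+ 2 + (1 - a) * t + 1 = 0 -> s ^+ 4 + 2 * a * s ^+ 2 + 1 = 0 -> False.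
Proof.
move=> am1 et es.
have t0 : t != 0 by apply/eqP => h; move: et; rewrite h; clear; lra.
have s0 : s != 0 by apply/eqP => h; move: es; rewrite h; clear; lra.
have t1 : t + 1 != 0.
  apply: contraNneq am1 => h; have {}h : t = -1 by lra.
  by apply/eqP; move: et; rewrite h; lra.
have key : (s ^+ 4 + 6 * s ^+ 2 + 1) * (t + 1) ^+ 2 = ((t - 1) * (s ^+ 2 - 1)) ^+ 2.
  apply: (lin_comb (c := - 8 * s ^+ 2) et). 
  apply: (lin_comb (c := - 4 * t) es); ring.
have s1 : s ^+ 2 != 1.
  apply: contraNneq am1 => h; move: es.
  have -> : s ^+ 4 = (s ^+ 2) ^+ 2 by ring.
  rewrite h => es.
  by apply/eqP; lra.
case/eqP: s0; apply: (@rat_quartic_1_6_1 s ((t - 1) * (s ^+ 2 - 1) / (t + 1))).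
- by apply: contraNneq s1 => ->; rewrite expr1n.
- by apply: contraNneq s1 => ->; rewrite sqrrN expr1n.
- by rewrite expr_div_n -key mulfK // expf_neq0.
Qed.

Lemma preimage_infty_2cycle (a t s : rat) : a != -1 ->
  t ^+ 2 + a = 0 -> s ^+ 4 + 2 * a * s ^+ 2 + 1 = 0 -> False.
Proof.
move=> am1 et es.
have s0 : s != 0 by apply/eqP => h; move: es; rewrite h; clear; lra.
have s2 : s ^+ 2 = 1.
  apply: (@rat_fourth_powers s (s * t) s0).
  by apply: (lin_comb (c := 2 * s ^+ 2) et); apply: (lin_comb (c := -1) es); ring.
move: es; have -> : s ^+ 4 = (s ^+ 2) ^+ 2 by ring.
rewrite s2 => es.
by case/eqP: am1; lra.
Qed.

(** * The set of candidate points *)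

Lemma admissible_neq a : admissible a -> (a != 1) * (a != -1).
Proof. by case=> /eqP a1 /eqP am1. Qed.

Lemma fa_pt a z w : admissible a -> fa a (Some z) = Some w <-> maps a z w.
Proof.
move=> /admissible_neq[a1 am1]; rewrite /fa /maps; split.
  by case: eqP => // /eqP nz [<-]; rewrite divfK.
move=> e; case: eqP => [d0|/eqP nz]; last by rewrite e mulfK.
exfalso; rewrite d0 mulr0 in e.
have : (a - 1) * (a + 1) = 0.
  apply: (lin_comb (c := - (a * z ^+ 2 - 1 + a ^+ 2)) e).
  by apply: (lin_comb (c := a ^+ 2 * z) d0); ring.
by move/eqP; rewrite mulf_eq0 subr_eq0 addr_eq0 (negbTE a1) (negbTE am1).
Qed.

Lemma fa_infty a z : fa a (Some z) = None <-> z = 0 \/ z ^+ 2 + a = 0.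
Proof.
have -> : fa a (Some z) = if z * (z ^+ 2 + a) == 0 then None else
    Some ((a * z ^+ 2 + 1) / (z ^+ 3 + a * z)).
  by rewrite /fa (_ : z * (z ^+ 2 + a) = z ^+ 3 + a * z) //; ring.
rewrite mulf_eq0; case: orP => [[] /eqP h|h]; split=> //.
- by left.
- by right.
by case=> /eqP e; case: h; [left | right].
Qed.

(* Up to [maps_preimage1] and its analogues, all possible preperiodic points:
   0, 1, -1, oo, the preimages of 1, -1, 0 and oo, and the points of period 2. *)
Definition candidate (a : rat) (P : option rat) : bool :=
  if P is Some z then
    [|| z == 0, z == 1, z == -1, z ^+ 2 + (1 - a) * z + 1 == 0,
        z ^+ 2 + (a - 1) * z + 1 == 0, a * z ^+ 2 + 1 == 0, z ^+ 2 + a == 0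
      | z ^+ 4 + 2 * a * z ^+ 2 + 1 == 0]
  else true.

Lemma preimage_of1 a z : maps a z 1 -> z = 1 \/ z ^+ 2 + (1 - a) * z + 1 = 0.
Proof.
move=> e; have /eqP : (z - 1) * (z ^+ 2 + (1 - a) * z + 1) = 0.
  by apply: (lin_comb (c := 1) e); ring.
by rewrite mulf_eq0 subr_eq0 => /orP[] /eqP; [left | right].
Qed.

(** This backward closure is what turns knowledge of cycles into knowledge of all tails: first
    preimages of the base points have no rational preimages, and a point w in one of the further
    2-cycles has only -w. *)
Lemma candidate_preimage a P : admissible a -> candidate a (fa a P) -> candidate a P.
Proof.
move=> adm; have [a1 am1] := admissible_neq adm.
case: P => [z|] //; case e: (fa a (Some z)) => [w|]; last first.
  by move: e => /fa_infty[] e _; rewrite /candidate e eqxx ?orbT.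
move/fa_pt: e => /(_ adm) e.
have to1 : w = 1 -> candidate a (Some z).
  move=> w1; rewrite w1 in e; rewrite /candidate.
  by case: (preimage_of1 e) => ->; rewrite eqxx !orbT.
have tom1 : w = -1 -> candidate a (Some z).
  move=> wm1; move: (maps_opp e); rewrite wm1 opprK /candidate => {}e.
  case: (preimage_of1 e) => h.
    have -> : z = -1 by rewrite -h opprK.
    by rewrite eqxx !orbT.
  have -> : z ^+ 2 + (a - 1) * z + 1 = 0 by rewrite -h; ring.
  by rewrite eqxx !orbT.
rewrite {1}/candidate; case/orP=> [/eqP w0|].
  have h : a * z ^+ 2 + 1 = 0 by move: e; rewrite /maps w0 mul0r.
  by rewrite /candidate h eqxx !orbT.
case/orP=> [/eqP|]; first exact: to1.
case/orP=> [/eqP|]; first exact: tom1.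
case/orP=> [/eqP h|].
  by have [/to1 //|w1] := eqVneq w 1; case: (maps_preimage1 am1 w1 h e).
case/orP=> [/eqP h|].
  have [/tom1 //|w1] := eqVneq w (-1).
  case: (@maps_preimage1 a (- w) (- z)) => //; last exact: maps_opp.
    by rewrite eqr_oppLR.
  by rewrite -h; ring.
case/orP=> [/eqP h|]; first by case: (maps_preimage0 am1 h e).
case/orP=> [/eqP h|/eqP h]; first by case: (maps_preimage_infty am1 h e).
have h' : z ^+ 4 + 2 * a * z ^+ 2 + 1 = 0.
  by rewrite (maps_preimage_2cycle am1 h e) -h; ring.
by rewrite /candidate h' eqxx !orbT.
Qed.

Lemma candidate_preperiodic a P : admissible a -> candidate a P -> preperiodic (fa a) P.
Proof.
move=> adm.
have fpt z w : maps a z w -> fa a (Some z) = Some w by move/(fa_pt z w adm).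
have finf z : z = 0 \/ z ^+ 2 + a = 0 -> fa a (Some z) = None by move/fa_infty.
have per0 : periodic (fa a) (Some 0).
  by exists 2%N; rewrite /= (finf 0 (or_introl erefl)).
have perinf : periodic (fa a) None by exists 2%N; rewrite /= (finf 0 (or_introl erefl)).
have per1 : periodic (fa a) (Some 1).
  by exists 1%N; split=> //=; apply: fpt; rewrite /maps; ring.
have perm1 : periodic (fa a) (Some (-1)).
  by exists 1%N; split=> //=; apply: fpt; rewrite /maps; ring.
case: P => [z|]; last by exists 0%N.
rewrite /candidate; case/orP=> [/eqP ->|]; first by exists 0%N.
case/orP=> [/eqP ->|]; first by exists 0%N.
case/orP=> [/eqP ->|]; first by exists 0%N.
case/orP=> [/eqP e|].
  exists 1%N; rewrite /= (fpt z 1) //; apply: (lin_comb (c := z - 1) e); ring.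
case/orP=> [/eqP e|].
  exists 1%N; rewrite /= (fpt z (-1)) //; apply: (lin_comb (c := - z - 1) e); ring.
case/orP=> [/eqP e|].
  exists 1%N; rewrite /= (fpt z 0) //; apply: (lin_comb (c := -1) e); ring.
case/orP=> [/eqP e|/eqP e].
  by exists 1%N; rewrite /= finf //; right.
exists 0%N, 2%N; split=> //=.
rewrite (fpt z (- z)); last by apply: (lin_comb (c := -1) e); ring.
by apply: fpt; apply: (lin_comb (c := -1) e); ring.
Qed.

Definition no_long_cycle := ~ (exists a : rat, admissible a /\
       exists (P : option rat) (n : nat),
         (4 <= n)%N /\ minimal_period (fa a) P n).

Lemma periodic_minimal (T : eqType) (f : T -> T) P : periodic f P ->
  exists n, minimal_period f P n.
Proof.
move=> [n [n0 e]]; have ex : exists n, (0 < n)%N && (iter n f P == P).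
  by exists n; rewrite n0 e eqxx.
case: (ex_minnP ex) => m /andP[m0 /eqP em] hm; exists m; split=> // k /andP[k0 lt] ek.
by move: (hm k); rewrite k0 ek eqxx leqNgt lt => /(_ isT).
Qed.

Lemma periodic_candidate a P : no_long_cycle -> admissible a ->
  periodic (fa a) P -> candidate a P.
Proof.
move=> H adm /periodic_minimal[n [n0 en hn]]; have [a1 am1] := admissible_neq adm.
case: (ltnP n 4) => [lt4|ge4]; last by case: H; exists a; split=> //; exists P, n.
have fpt z w : fa a (Some z) = Some w -> maps a z w by move/(fa_pt z w adm).
case: P en hn => [x|] // en hn.
case e: (fa a (Some x)) => [y|]; last by case/fa_infty: e => e; rewrite /candidate e eqxx ?orbT.
have exy := fpt _ _ e.
case: n n0 lt4 en hn => [|[|[|[|//]]]] // _ _.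
- by rewrite /= e => -[ey]; rewrite ey in exy; case: (maps_fixed exy) => ->; rewrite /candidate eqxx ?orbT.
- rewrite /= e => eyx /(_ 1%N isT) /=; rewrite e => nyx; have {}eyx := fpt _ _ eyx.
  have xy : x != y by apply/eqP => h; apply: nyx; rewrite h.
  by have [_ h] := maps_2cycle a1 am1 xy exy eyx; rewrite /candidate h eqxx !orbT.
rewrite /= e; case e2: (fa a (Some y)) => [w|] ewx hn; last first.
  by case: ewx => <-; rewrite /candidate eqxx.
have eyw := fpt _ _ e2; have {}ewx := fpt _ _ ewx.
have h1 := hn 1%N isT; have h2 := hn 2%N isT; rewrite /= e in h1 h2; rewrite e2 in h2.
have xy : x != y by apply/eqP => h; apply: h1; rewrite h.
have wx : w != x by apply/eqP => h; apply: h2; rewrite h.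
have yw : y != w.
  apply/eqP => h; case/eqP: wx; rewrite -h in e2 ewx *.
  by move/(fa_pt y x adm): ewx; rewrite e2 => -[].
by case: (maps_3cycle xy yw wx exy eyw ewx).
Qed.

Lemma preperiodic_candidate a P : no_long_cycle -> admissible a ->
  preperiodic (fa a) P <-> candidate a P.
Proof.
move=> H adm; split; last exact: candidate_preperiodic.
case=> m /(periodic_candidate H adm); elim: m => // m IHm /= c.
by apply: IHm; apply: candidate_preimage.
Qed.

(** * Parametrised families and their graphs *)

Lemma preperiodic_graph_listed (T : eqType) (f : T -> T) vs : uniq vs ->
  (forall P, preperiodic f P <-> P \in vs) ->
  graph_listed (preperiodic_graph f) vs [seq (P, f P) | P <- vs].
Proof.
move=> u h; split=> //= P Q; split=> [[pP ->]|/mapP[R Rvs [-> ->]]].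
  by apply/map_f/h.
by split=> //; apply/h.
Qed.

(** The condition z != 1 matters at a = 3, where 1 is a double root and no new point arises. The
    excluded value t = -1 is a = -1. *)
Lemma family2P (a : rat) : admissible a ->
  family2 a <-> exists2 z : rat, z != 1 & z ^+ 2 + (1 - a) * z + 1 = 0.
Proof.
move=> /admissible_neq[a1 am1]; split=> [[t [t1 tm1 t0] ea]|[t t1 et]].
  exists t; first exact/eqP.
  by rewrite ea; field; apply/eqP.
have t0 : t != 0 by apply/eqP => h; move: et; rewrite h; clear; lra.
exists t; last by apply: (mulIf t0); rewrite mulfVK //; apply: (lin_comb (c := 1) et); ring.
split; try exact/eqP.
by move=> h; case/eqP: am1; move: et; rewrite h; clear; lra.
Qed.

Lemma family3P (a : rat) : admissible a ->
  family3 a <-> exists z : rat, z ^+ 4 + 2 * a * z ^+ 2 + 1 = 0.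
Proof.
move=> /admissible_neq[a1 am1]; split=> [[t [t1 tm1 t0] ea]|[t et]].
  by exists t; rewrite ea; field; apply/eqP.
have t0 : t != 0 by apply/eqP => h; move: et; rewrite h; clear; lra.
exists t.
  by split=> [h|h|]; try exact/eqP; case/eqP: am1; move: et; rewrite h; clear; lra.
apply: (mulIf (_ : 2 * t ^+ 2 != 0)); first by rewrite mulf_neq0 ?expf_neq0.
by rewrite mulfVK ?mulf_neq0 ?expf_neq0 //; apply: (lin_comb (c := -1) et); ring.
Qed.

(** Only a = 0 needs the condition z != 0; the excluded values 1 and -1 of t both give a = -1. *)
Lemma family4P (a : rat) : admissible a ->
  family4 a <-> exists2 z : rat, z != 0 & z ^+ 2 + a = 0.
Proof.
move=> /admissible_neq[a1 am1]; split=> [[t [t1 tm1 t0] ea]|[t t0 et]].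
  by exists t; [exact/eqP | rewrite ea; ring].
have ea : a = - t ^+ 2 by apply: (lin_comb (c := -1) et); ring.
exists t => //; split; try exact/eqP.
  by move=> h; case/eqP: am1; rewrite ea h; ring.
by move=> h; case/eqP: am1; rewrite ea h; ring.
Qed.

Lemma mem_base z : (Some z \in base_vertices) = [|| z == 1, z == -1 | z == 0].
Proof. by rewrite !inE orbF. Qed.

(** The symmetries z -> -z and z -> 1/z fold preimages of -1 onto those of 1, and preimages of 0
    onto those of oo, leaving one case per family. *)
Lemma candidate_cases a z : candidate a (Some z) ->
  [\/ Some z \in base_vertices,
      exists2 t, t != 1 /\ t ^+ 2 + (1 - a) * t + 1 = 0 & z = t \/ z = - t,
      exists2 t, t != 0 /\ t ^+ 2 + a = 0 & z = t \/ z = t^-1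
    | z ^+ 4 + 2 * a * z ^+ 2 + 1 = 0].
Proof.
have [b|nb] := boolP (Some z \in base_vertices); first by constructor 1.
move: (nb); rewrite mem_base /candidate !negb_or => /and3P[z1 zm1 z0].
rewrite (negbTE z0) (negbTE z1) (negbTE zm1) /=.
case/orP=> [/eqP h|]; first by constructor 2; exists z; [split | left].
case/orP=> [/eqP h|].
  constructor 2; exists (- z); last by right; rewrite opprK.
  by split; [rewrite eqr_oppLR | rewrite -h; ring].
case/orP=> [/eqP h|].
  constructor 3; exists z^-1; last by right; rewrite invrK.
  split; first by rewrite invr_eq0.
  apply: (mulfI (_ : z ^+ 2 != 0)); first by rewrite expf_neq0.
  by apply: (lin_comb (c := -1) h); field.
case/orP=> [/eqP h|/eqP h]; last by constructor 4.
by constructor 3; exists z; [split | left].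
Qed.

Lemma base_edgesE a : admissible a ->
  [seq (P, fa a P) | P <- base_vertices] = base_edges.
Proof.
move=> adm; rewrite /= (_ : fa a None = pt 0) //.
rewrite (_ : fa a (pt 1) = pt 1); last by apply/(fa_pt _ _ adm); rewrite /maps; ring.
rewrite (_ : fa a (pt (-1)) = pt (-1)); last by apply/(fa_pt _ _ adm); rewrite /maps; ring.
by rewrite (_ : fa a (pt 0) = None) //; apply/fa_infty; left.
Qed.

Lemma uniq_base_symmetric (t : rat) : t != 0 -> t != 1 -> t != -1 ->
  uniq (base_vertices ++ [:: pt t; pt (- t); pt t^-1; pt (- t^-1)]).
Proof.
move=> t0 t1 tm1.
have neqV : t != t^-1.
  apply/eqP => h; have /eqP : (t - 1) * (t + 1) = 0.
    have -> : (t - 1) * (t + 1) = t * t - 1 by ring.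
    by rewrite {2}h mulfV // subrr.
  by rewrite mulf_eq0 subr_eq0 addr_eq0 (negbTE t1) (negbTE tm1).
have neqNV : t != - t^-1.
  apply/eqP => h; have : t ^+ 2 + 1 = 0 by rewrite expr2 {2}h mulrN mulfV // addNr.
  by apply/eqP; rewrite lt0r_neq0 // ltr_wpDl ?sqr_ge0.
have V0 : t^-1 != 0 by rewrite invr_eq0.
have V1 : t^-1 != 1 by rewrite invr_eq1.
have Vm1 : t^-1 != -1 by rewrite -(inj_eq invr_inj) invrK invrN invr1.
have eqS (x y : rat) : (Some x == Some y) = (x == y) by [].
rewrite /= !inE !eqS /= !negb_or.
(* With t^-1 generalised to s, every remaining coincidence is a linear relation contradicting one of
   the eight inequalities. *)
move: (t^-1) V0 V1 Vm1 neqV neqNV => s.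
move: t0 t1 tm1 => /eqP n1 /eqP n2 /eqP n3 /eqP n4 /eqP n5 /eqP n6 /eqP n7 /eqP n8.
do ![apply/andP; split] => //; apply/eqP => h;
  first [ case: n1; lra | case: n2; lra | case: n3; lra | case: n4; lra
     | case: n5; lra | case: n6; lra | case: n7; lra | case: n8; lra ].
Qed.

Lemma graph_listed_inj (T : eqType) (G : digraph T) vs u vs' es es' :
  graph_listed G (vs ++ u :: vs') es -> graph_listed G vs es' -> False.
Proof.
case=> uvs hv _ [_ hv' _]; have /hv' uin : vertex G u by apply/hv; rewrite mem_cat mem_head orbT.
by move: uvs; rewrite cat_uniq /= uin /= andbF.
Qed.

(** The order of [rs] fixes the order of the edges, so each family passes its four points in the
    order that its graph shape prescribes. *)
Lemma preperiodic_listed a (rs : seq rat) : no_long_cycle -> admissible a ->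
  uniq (base_vertices ++ map Some rs) ->
  (forall z, candidate a (Some z) -> Some z \in base_vertices \/ z \in rs) ->
  (forall z, z \in rs -> candidate a (Some z)) ->
  graph_listed (preperiodic_graph (fa a)) (base_vertices ++ map Some rs)
    (base_edges ++ [seq (P, fa a P) | P <- map Some rs]).
Proof.
move=> H adm un to from; rewrite -(base_edgesE adm) -map_cat.
apply: preperiodic_graph_listed => // P; apply: (iff_trans (preperiodic_candidate P H adm)).
rewrite mem_cat; split=> [|/orP[Pb|/mapP[z zrs ->]]]; last exact: from.
  case: P => [z|] // /to[->|zrs] //; apply/orP; right; exact: map_f.
by case: P Pb => [z|] //; rewrite mem_base => /or3P[] /eqP ->; rewrite /candidate eqxx ?orbT.
Qed.

Lemma fa_preimage1 a t : admissible a -> t ^+ 2 + (1 - a) * t + 1 = 0 -> fa a (pt t) = pt 1.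
Proof. by move=> adm e; apply/(fa_pt _ _ adm); apply: (lin_comb (c := t - 1) e); ring. Qed.

Lemma fa_preimagem1 a t : admissible a -> t ^+ 2 + (1 - a) * t + 1 = 0 -> fa a (pt (- t)) = pt (-1).
Proof. by move=> adm e; apply/(fa_pt _ _ adm); apply: (lin_comb (c := t - 1) e); ring. Qed.

Lemma fa_2cycle a t : admissible a -> t ^+ 4 + 2 * a * t ^+ 2 + 1 = 0 -> fa a (pt t) = pt (- t).
Proof. by move=> adm e; apply/(fa_pt _ _ adm); apply: (lin_comb (c := -1) e); ring. Qed.

Lemma fa_preimage0 a t : admissible a -> t != 0 -> t ^+ 2 + a = 0 -> fa a (pt t^-1) = pt 0.
Proof.
move=> adm t0 e; apply/(fa_pt _ _ adm); apply: (mulfI (_ : t ^+ 2 != 0)).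
  by rewrite expf_neq0.
by apply: (lin_comb (c := -1) e); field.
Qed.

Lemma family2_G2 a (no_long : no_long_cycle) (adm : admissible a) : family2 a -> is_G2 (preperiodic_graph (fa a)).
Proof.
have [a1 am1] := admissible_neq adm.
case/(family2P adm) => t t1 et.
have t0 : t != 0 by apply/eqP => h; move: et; rewrite h; clear; lra.
have tm1 : t != -1 by apply: contraNneq am1 => h; apply/eqP; move: et; rewrite h; clear; lra.
have etV : t^-1 ^+ 2 + (1 - a) * t^-1 + 1 = 0.
  apply: (mulfI (_ : t ^+ 2 != 0)); first by rewrite expf_neq0.
  by apply: (lin_comb (c := -1) et); field.
exists (pt t), (pt t^-1), (pt (- t)), (pt (- t^-1)).
have un : uniq (base_vertices ++ map Some [:: t; t^-1; - t; - t^-1]).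
  rewrite -(@perm_uniq _ (base_vertices ++ [:: pt t; pt (- t); pt t^-1; pt (- t^-1)])).
    exact: uniq_base_symmetric.
  by apply/permP => p /=; ring.
have := @preperiodic_listed a [:: t; t^-1; - t; - t^-1] no_long adm un.
rewrite /= (fa_preimage1 adm et) (fa_preimage1 adm etV).
rewrite (fa_preimagem1 adm et) (fa_preimagem1 adm etV); apply.
- move=> z /candidate_cases[b|[s [_ es] ez]|[s [_ es] _]|ez].
  + by left.
  (* The quadratic has constant term 1, so its roots are t and t^-1. *)
  + right; have /eqP : (s - t) * (t * s - 1) = 0.
      by apply: (lin_comb (c := - t) es); apply: (lin_comb (c := s) et); ring.
    rewrite mulf_eq0 !subr_eq0 => /orP[/eqP|/eqP h].
      by move=> h; case: ez => ->; rewrite h !inE eqxx ?orbT.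
    have {}h : s = t^-1 by apply: (mulfI t0); rewrite h mulfV.
    by case: ez => ->; rewrite h !inE eqxx ?orbT.
  + by case: (preimage1_preimage_infty am1 et es).
  + by case: (preimage1_2cycle am1 et ez).
- have cand x : x ^+ 2 + (1 - a) * x + 1 = 0 -> candidate a (Some x).
    by move=> e; rewrite /candidate e eqxx !orbT.
  have candN x : x ^+ 2 + (1 - a) * x + 1 = 0 -> candidate a (Some (- x)).
    move=> e; have h : (- x) ^+ 2 + (a - 1) * (- x) + 1 = 0 by rewrite -e; ring.
    by rewrite /candidate h eqxx !orbT.
  by move=> z; rewrite !inE => /or4P[] /eqP ->; by [apply: cand | apply: candN].
Qed.

Lemma family3_G3 a (no_long : no_long_cycle) (adm : admissible a) : family3 a -> is_G3 (preperiodic_graph (fa a)).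
Proof.
have [a1 am1] := admissible_neq adm.
case/(family3P adm) => t et.
have t0 : t != 0 by apply/eqP => h; move: et; rewrite h; clear; lra.
have t1 : t != 1 by apply: contraNneq am1 => h; apply/eqP; move: et; rewrite h; clear; lra.
have tm1 : t != -1 by apply: contraNneq am1 => h; apply/eqP; move: et; rewrite h; clear; lra.
have etV : t^-1 ^+ 4 + 2 * a * t^-1 ^+ 2 + 1 = 0.
  apply: (mulfI (_ : t ^+ 4 != 0)); first by rewrite expf_neq0.
  by apply: (lin_comb (c := -1) et); field.
have neg x : x ^+ 4 + 2 * a * x ^+ 2 + 1 = 0 -> (- x) ^+ 4 + 2 * a * (- x) ^+ 2 + 1 = 0.
  by move=> <-; ring.
exists (pt t), (pt (- t)), (pt t^-1), (pt (- t^-1)).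
have := @preperiodic_listed a [:: t; - t; t^-1; - t^-1] no_long adm (uniq_base_symmetric t0 t1 tm1).
rewrite /= (fa_2cycle adm et) (fa_2cycle adm (neg _ et)).
rewrite (fa_2cycle adm etV) (fa_2cycle adm (neg _ etV)) !opprK.
apply=> [z /candidate_cases[b|[s [_ es] _]|[s [_ es] _]|ez]|z].
- by left.
- by case: (preimage1_2cycle am1 es et).
- by case: (preimage_infty_2cycle am1 es et).
- right; have /eqP : (z - t) * ((z + t) * ((t * z - 1) * (t * z + 1))) = 0.
    by apply: (lin_comb (c := - t ^+ 2) ez); apply: (lin_comb (c := z ^+ 2) et); ring.
  rewrite !mulf_eq0 !subr_eq0 !addr_eq0 !inE => /or4P[] // h; rewrite ?h ?orbT //.
    by rewrite (_ : z = t^-1) ?eqxx ?orbT //; apply: (mulfI t0); rewrite (eqP h) mulfV.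
  by rewrite (_ : z = - t^-1) ?eqxx ?orbT //; apply: (mulfI t0); rewrite (eqP h) mulrN mulfV.
have cand x : x ^+ 4 + 2 * a * x ^+ 2 + 1 = 0 -> candidate a (Some x).
  by move=> e; rewrite /candidate e eqxx !orbT.
by rewrite !inE => /or4P[] /eqP ->; apply: cand => //; apply: neg.
Qed.

Lemma family4_G4 a (no_long : no_long_cycle) (adm : admissible a) : family4 a -> is_G4 (preperiodic_graph (fa a)).
Proof.
have [a1 am1] := admissible_neq adm.
case/(family4P adm) => t t0 et.
have t1 : t != 1 by apply: contraNneq am1 => h; apply/eqP; move: et; rewrite h; clear; lra.
have tm1 : t != -1 by apply: contraNneq am1 => h; apply/eqP; move: et; rewrite h; clear; lra.
have eNt : (- t) ^+ 2 + a = 0 by rewrite sqrrN.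
have Nt0 : - t != 0 by rewrite oppr_eq0.
exists (pt t^-1), (pt (- t^-1)), (pt t), (pt (- t)).
have un : uniq (base_vertices ++ map Some [:: t^-1; - t^-1; t; - t]).
  rewrite -{3 4}[t]invrK; apply: uniq_base_symmetric; rewrite ?invr_eq0 ?invr_eq1 //.
  by rewrite -(inj_eq invr_inj) invrK invrN invr1.
have := @preperiodic_listed a [:: t^-1; - t^-1; t; - t] no_long adm un.
have finf x : x ^+ 2 + a = 0 -> fa a (Some x) = None by move=> e; apply/fa_infty; right.
have e2 := fa_preimage0 adm Nt0 eNt; rewrite invrN in e2.
rewrite /= (fa_preimage0 adm t0 et) e2 (finf _ et) (finf _ eNt).
apply=> [z /candidate_cases[b|[s [_ es] _]|[s [_ es] ez]|ez]|z].
- by left.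
- by case: (preimage1_preimage_infty am1 es et).
- right; have /eqP : (s - t) * (s + t) = 0.
    by apply: (lin_comb (c := - 1) es); apply: (lin_comb (c := 1) et); ring.
  rewrite mulf_eq0 subr_eq0 addr_eq0 !inE.
  by case/orP=> /eqP h; case: ez => ->; rewrite h ?invrN eqxx ?orbT.
- by case: (preimage_infty_2cycle am1 et ez).
have cand x : x ^+ 2 + a = 0 -> candidate a (Some x).
  by move=> e; rewrite /candidate e eqxx !orbT.
have candV x : x != 0 -> x ^+ 2 + a = 0 -> candidate a (Some x^-1).
  move=> x0 e; have h : a * x^-1 ^+ 2 + 1 = 0; last by rewrite /candidate h eqxx !orbT.
  apply: (mulfI (_ : x ^+ 2 != 0)); first by rewrite expf_neq0.
  by apply: (lin_comb (c := -1) e); field.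
rewrite !inE => /or4P[] /eqP ->.
- exact: candV.
- by rewrite -invrN; apply: candV.
- exact: cand.
- exact: cand.
Qed.

Lemma no_family_G1 a (no_long : no_long_cycle) (adm : admissible a) : ~ family2 a -> ~ family3 a -> ~ family4 a ->
  is_G1 (preperiodic_graph (fa a)).
Proof.
move=> n2 n3 n4; have := @preperiodic_listed a [::] no_long adm isT; apply=> // z.
case/candidate_cases=> [b|[s [s1 es] _]|[s [s0 es] _]|ez]; first by left.
- by case: n2; apply/(family2P adm); exists s.
- by case: n4; apply/(family4P adm); exists s.
- by case: n3; apply/(family3P adm); exists z.
Qed.

(** A single edge into 1 from outside the base vertices already produces the parameter. *)
Lemma G2_family2 a (adm : admissible a) : is_G2 (preperiodic_graph (fa a)) -> family2 a.
Proof.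
case=> [u [v [u' [v' [un _ he]]]]].
have [_ eu] : edge (preperiodic_graph (fa a)) u (pt 1) by apply/he; rewrite !inE eqxx !orbT.
have ub : u \notin base_vertices.
  by move: un; rewrite cat_uniq => /and3P[_ /hasPn/(_ u)]; rewrite mem_head => /(_ isT).
case: u ub eu {un he} => [z|] ub eu; last by [].
case: (preimage_of1 (iffLR (fa_pt _ _ adm) (esym eu))) => [z1|ez].
  by rewrite z1 mem_base in ub.
apply/(family2P adm); exists z => //.
by move: ub; rewrite mem_base negb_or => /andP[].
Qed.

Lemma G3_family3 a (adm : admissible a) : is_G3 (preperiodic_graph (fa a)) -> family3 a.
Proof.
have [a1 am1] := admissible_neq adm.
case=> [u [v [u' [v' [un _ he]]]]].
have [_ eu] : edge (preperiodic_graph (fa a)) u v by apply/he; rewrite !inE eqxx !orbT.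
have [_ ev] : edge (preperiodic_graph (fa a)) v u by apply/he; rewrite !inE eqxx !orbT.
move: un; rewrite cat_uniq => /and3P[_ /hasPn nb /=].
rewrite !inE !negb_or => /andP[/andP[uv _] _].
have ub := nb u (mem_head _ _); have vb : v \notin base_vertices by apply: nb; rewrite !inE eqxx orbT.
case: u v ub vb uv eu ev {he nb} => [x|] [y|] // _ _ xy eu ev.
have [_ e] := maps_2cycle a1 am1 xy (iffLR (fa_pt _ _ adm) (esym eu)) (iffLR (fa_pt _ _ adm) (esym ev)).
by apply/(family3P adm); exists x.
Qed.

Lemma G4_family4 a (adm : admissible a) : is_G4 (preperiodic_graph (fa a)) -> family4 a.
Proof.
case=> [u [v [u' [v' [un _ he]]]]].
have [_ eu] : edge (preperiodic_graph (fa a)) u (pt 0) by apply/he; rewrite !inE eqxx !orbT.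
have ub : u \notin base_vertices.
  by move: un; rewrite cat_uniq => /and3P[_ /hasPn/(_ u)]; rewrite mem_head => /(_ isT).
case: u ub eu {un he} => [z|] ub eu; last by [].
have e := iffLR (fa_pt _ _ adm) (esym eu).
have z0 := maps_neq0 e; apply/(family4P adm); exists z^-1; first by rewrite invr_eq0.
apply: (mulfI (_ : z ^+ 2 != 0)); first by rewrite expf_neq0.
by apply: (lin_comb (c := -1) e); field.
Qed.

Lemma G1_no_family a (no_long : no_long_cycle) (adm : admissible a) :
  is_G1 (preperiodic_graph (fa a)) -> ~ family2 a /\ ~ family3 a /\ ~ family4 a.
Proof.
move=> g1; split; last split.
- by case/(family2_G2 no_long adm)=> [u [v [u' [v' /graph_listed_inj]]]]; apply; exact: g1.
- by case/(family3_G3 no_long adm)=> [u [v [u' [v' /graph_listed_inj]]]]; apply; exact: g1.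
- by case/(family4_G4 no_long adm)=> [u [v [u' [v' /graph_listed_inj]]]]; apply; exact: g1.
Qed.

Theorem theorem6p12 :
  ~ (exists a : rat, admissible a /\
       exists (P : option rat) (n : nat),
         (4 <= n)%N /\ minimal_period (fa a) P n) ->
  (forall a : rat, admissible a ->
     let G := preperiodic_graph (fa a) in
     [/\ [\/ is_G1 G, is_G2 G, is_G3 G | is_G4 G],
         is_G1 G <-> ~ family2 a /\ ~ family3 a /\ ~ family4 a,
         is_G2 G <-> family2 a,
         is_G3 G <-> family3 a &
         is_G4 G <-> family4 a]) /\
  [/\ exists a : rat, admissible a /\ is_G1 (preperiodic_graph (fa a)),
      exists a : rat, admissible a /\ is_G2 (preperiodic_graph (fa a)),
      exists a : rat, admissible a /\ is_G3 (preperiodic_graph (fa a)) &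
      exists a : rat, admissible a /\ is_G4 (preperiodic_graph (fa a))].
Proof.
move=> no_long; split=> [a adm G|].
  split; last 4 first.
  - split; first exact: G1_no_family.
    by case=> n2 [n3 n4]; apply: no_family_G1.
  - by split; [apply: G2_family2 | apply: family2_G2].
  - by split; [apply: G3_family3 | apply: family3_G3].
  - by split; [apply: G4_family4 | apply: family4_G4].
  have [f2|n2] := classic (family2 a); first by constructor 2; apply: family2_G2.
  have [f3|n3] := classic (family3 a); first by constructor 3; apply: family3_G3.
  have [f4|n4] := classic (family4 a); first by constructor 4; apply: family4_G4.
  by constructor 1; apply: no_family_G1.
(* The value t = 2 gives the witnesses 7/2, -17/8 and -4 for the three families. The witness a = 0
   lies in none: z^2 + z + 1 and z^4 + 1 have no real root, and z^2 = 0 only at z = 0. *)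
have par2 : parameter 2 by [].
split.
- have adm : admissible 0 by [].
  exists 0; split=> //; apply: no_family_G1 => //.
  + by case/(family2P adm) => z _; have := sqr_ge0 (2 * z + 1); nra.
  + by case/(family3P adm) => z; have := sqr_ge0 (z ^+ 2); nra.
  + by case/(family4P adm) => z z0; rewrite addr0 => /eqP; rewrite expf_eq0 (negbTE z0).
- have adm : admissible (7 / 2) by split=> h; lra.
  exists (7 / 2); split=> //; apply: family2_G2 => //; exists 2 => //.
- have adm : admissible (- 17 / 8) by split=> h; lra.
  exists (- 17 / 8); split=> //; apply: family3_G3 => //; exists 2 => //.
- have adm : admissible (- 4) by split=> h; lra.
  exists (- 4); split=> //; apply: family4_G4 => //; exists 2 => //.
Qed.
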